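(* Let $\theta>0$ and assume that $\phi$ and $\ln(1+\theta\phi)$ belong to $L^1([0,T],\lambda(s)\,ds)$ for every $T>0$. Assume that $$\lim_{t\to\infty}\int_0^t\phi^2(s)\lambda(s)\,ds=\infty$$ and that $$\lim_{t\to\infty}\frac{\int_0^t\phi^{2+j}(s)\lambda(s)\,ds}{\int_0^t\phi^2(s)\lambda(s)\,ds}=0\quad\text{for every } j>0.$$ Then the maximum likelihood estimator $\hat\theta_t$ (defined in the context) converges to $\theta$ as $t\to\infty$, $\mathbf P_\theta$-almost surely.
   Context: On a filtered probability space $(\Omega,\mathfrak F,(\mathfrak F_t)_{t\ge0},\mathbf P)$ let $\mu=\sum_{n\ge1}\delta_{(T_n,Z_n)}$ be an adapted marked Poisson point process, with strictly increasing positive jump times $T_n\to\infty$ and marks $Z_n\in E=\mathbb R$, with deterministic intensity measure (compensator) $\nu(ds,dz)=\lambda(s)\,ds\,\eta(dz)$, $\eta$ a probability measure. $K$ is a deterministic kernel such that: $K(t,s)=0$ for $s>t$; $K(t,t)=0$ for all $t$; $(s,z)\mapsto zK(t,s)$ is in $\mathcal L^2(\nu)$ for every $t>0$; $K$ is continuously differentiable in $t$ and $s$ on $\{(t,s):0<s<t\}$. It is assumed that $\nu$ and $K$ are such that there exists one and only one function $\phi$ with $\int_0^t\int_E zK(t,s)\phi(s)\,\nu(ds,dz)=t$ for all $t$; $\phi$ denotes this function. The likelihood function is $$Z^\theta_t=\left.\frac{d\mathbf P_\theta}{d\mathbf P}\right|_{\mathfrak F_t}=\mathcal{ED}\Bigl(\int_0^{\cdot}\int_E\theta\phi(s)\,(\mu-\nu)(ds,dz)\Bigr)_t,$$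 where $\mathcal{ED}(X)$ is the Doléans-Dade exponential, i.e. the solution $R$ of $R_t=1+\int_0^tR_{s^-}\,dX_s$, and $\mathbf P_\theta$ is the probability measure having density $Z^\theta_t$ with respect to $\mathbf P$ on each $\mathfrak F_t$. The estimator is $\hat\theta_t=\operatorname{argmax}_{\vartheta\ge0}Z^{\vartheta}_t$. *)

(* Defs.v *)
From HB Require Import structures.
From mathcomp Require Import all_boot all_order all_algebra.
From mathcomp Require Import all_classical all_reals all_analysis.
From mathcomp Require Import measurable_realfun.

Set Implicit Arguments.
Unset Strict Implicit.
Unset Printing Implicit Defensive.

Import Order.TTheory GRing.Theory Num.Theory.
Import numFieldNormedType.Exports.

Local Open Scope classical_set_scope.
Local Open Scope ring_scope.

(* The measure lambda(s) ds. Time is all of R here, but every set and integral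
   below is restricted to nonnegative times. *)
Definition time_intensity {R : realType} (lam : R -> R)
    (lam_ge0 : forall s, 0 <= lam s)
    (lam_meas : measurable_fun [set: measurableTypeR R] lam)
    (A : set (measurableTypeR R)) : \bar R :=
  (\int[lebesgue_measure]_(s in A) (lam s)%:E)%E.

Section time_intensity.
Context {R : realType} (lam : R -> R) (lam_ge0 : forall s, 0 <= lam s).
Context (lam_meas : measurable_fun [set: measurableTypeR R] lam).

Local Notation time_intensity := (time_intensity lam_ge0 lam_meas).

Let time_intensity0 : time_intensity set0 = 0%E.
Proof. by rewrite /time_intensity integral_set0. Qed.

Let time_intensity_ge0 A : (0 <= time_intensity A)%E.
Proof. by apply: integral_ge0 => s _; rewrite lee_fin. Qed.

Let time_intensity_sigma_additive : semi_sigma_additive time_intensity.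
Proof.
move=> /= A mA tA mUA; rewrite /time_intensity/= ge0_integral_bigcup//=.
- apply: is_cvg_ereal_nneg_natsum_cond => n _ _.
  by apply: integral_ge0 => s _; rewrite lee_fin.
- by apply/measurable_EFinP; exact: measurable_funTS.
- by move=> s _; rewrite lee_fin.
Qed.

HB.instance Definition _ := isMeasure.Build _ _ _ time_intensity
  time_intensity0 time_intensity_ge0 time_intensity_sigma_additive.

End time_intensity.

Section filtration.
Context d (Omega : measurableType d) (R : realType).
Implicit Types (F : R -> set (set Omega)) (P Q : probability Omega R).

Definition is_filtration F : Prop :=
  [/\ forall t, 0 <= t -> sigma_algebra [set: Omega] (F t),
      forall t, 0 <= t -> F t `<=` measurable &
      forall s t, 0 <= s -> s <= t -> F s `<=` F t].

(* z is the density dQ/dP on the sub-sigma-algebra G. *)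
Definition is_density_on (G : set (set Omega)) P Q (z : Omega -> R) : Prop :=
  [/\ forall B : set (measurableTypeR R), measurable B -> G (z @^-1` B),
      P.-integrable [set: Omega] (EFin \o z) &
      forall A, G A -> Q A = (\int[P]_(w in A) (z w)%:E)%E].

End filtration.

Section marked_point_process.
Context d (Omega : measurableType d) (R : realType).
Local Notation RE := (measurableTypeR R * measurableTypeR R)%type.
Implicit Types (T Z : nat -> Omega -> R) (F : R -> set (set Omega)).

(* The jumps are numbered from 0. *)
Definition jump_measure T Z (w : Omega) : set RE -> \bar R :=
  mseries (fun n => \d_((T n w, Z n w) : RE)) 0.

HB.instance Definition _ T Z w := Measure.on (jump_measure T Z w).

Definition is_jump_times T : Prop := forall w,
  [/\ 0 < T 0%N w, forall n, T n w < T n.+1 w &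
      T n w @[n --> \oo] --> +oo].

(* mu is adapted, and for every s the restriction of mu to ]s, +oo[ x E is a
   Poisson random measure of intensity nu which is independent of F_s. The
   second argument of [poisson_prob] is a dummy. *)
Definition is_poisson_process F (P : probability Omega R)
    (nu : set RE -> \bar R) (mu : Omega -> set RE -> \bar R) : Prop :=
  (forall (t : R) (A : set RE) (k : nat), 0 <= t -> measurable A ->
     A `<=` `]0, t] `*` setT -> F t [set w | mu w A = k%:R%:E]) /\
  (forall (s : R) (m : nat) (A : 'I_m -> set RE) (k : 'I_m -> nat)
      (G : set Omega), 0 <= s ->
     (forall i, measurable (A i)) ->
     (forall i, A i `<=` `]s, +oo[ `*` setT) ->
     (forall i, (nu (A i) < +oo)%E) ->
     trivIset setT A ->
     F s G ->
     P (G `&` [set w | forall i, mu w (A i) = (k i)%:R%:E]) =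
     (P G * \prod_(i < m) poisson_prob (fine (nu (A i))) 0 [set k i])%E).

End marked_point_process.

Section doleans_dade.
Context {R : realType}.
Local Notation RE := (measurableTypeR R * measurableTypeR R)%type.

Definition cadlag (Y : R -> R) : Prop :=
  (forall t, 0 <= t -> Y x @[x --> t^'+] --> Y t) /\
  (forall t, 0 < t -> cvg (Y x @[x --> t^'-])).

Definition left_limit (Y : R -> R) (t : R) : R := lim (Y x @[x --> t^'-]).

Definition compensated_integral (mu nu : {measure set RE -> \bar R})
    (H : RE -> R) (t : R) : R :=
  \int[mu]_(p in `]0, t] `*` setT) H p - \int[nu]_(p in `]0, t] `*` setT) H p.

(* Y = ED(X) for X_t = compensated_integral mu nu h t, one trajectory at a time:
   Y_t = 1 + int_0^t Y_(s-) dX_s. When mu has finitely many atoms on bounded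
   time intervals and h is locally nu-integrable, X has finite variation and
   dX_s is h(s,z) (mu - nu)(ds,dz); cadlag solutions have locally bounded left
   limits, so both integrals exist. *)
Definition is_doleans_dade (mu nu : {measure set RE -> \bar R}) (h : RE -> R)
    (Y : R -> R) : Prop :=
  cadlag Y /\
  forall t, 0 <= t ->
    Y t = 1 + compensated_integral mu nu (fun p => left_limit Y p.1 * h p) t.

End doleans_dade.

Section kernel.
Context {R : realType}.
Local Notation RE := (measurableTypeR R * measurableTypeR R)%type.
Implicit Types (K : R -> R -> R) (phi : R -> R).
Implicit Types nu : {measure set RE -> \bar R}.

(* In the last two clauses the point is p = (t, s). *)
Definition is_kernel K nu : Prop :=
  [/\ forall t s, t < s -> K t s = 0,
      forall t, K t t = 0,
      forall t, 0 < t ->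
        measurable_fun (`]0, +oo[ `*` setT : set RE)
          (fun p : RE => p.2 * K t p.1) /\
        nu.-integrable (`]0, +oo[ `*` setT)
          (fun p => ((p.2 * K t p.1) ^+ 2)%:E),
      forall p : R * R, 0 < p.2 < p.1 ->
        derivable (K ^~ p.2) p.1 1 /\
        {for p, continuous (fun q : R * R => derive1 (K ^~ q.2) q.1)} &
      forall p : R * R, 0 < p.2 < p.1 ->
        derivable (K p.1) p.2 1 /\
        {for p, continuous (fun q : R * R => derive1 (K q.1) q.2)}].

Definition solves_drift_equation K nu phi : Prop :=
  measurable_fun [set: measurableTypeR R] phi /\
  forall t, 0 <= t ->
    nu.-integrable (`]0, t] `*` setT) (fun p => (p.2 * K t p.1 * phi p.1)%:E) /\
    \int[nu]_(p in `]0, t] `*` setT) (p.2 * K t p.1 * phi p.1) = t.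

End kernel.

Section estimator.
Context {R : realType}.

Definition is_argmax_ge0 (f : R -> R) (v : R) : Prop :=
  0 <= v /\ forall u, 0 <= u -> f u <= f v.

(* L v t w is the likelihood of the parameter v at time t. The value of the
   estimator is unconstrained when the likelihood has no maximizer. *)
Definition is_mle (Omega : Type) (L : R -> R -> Omega -> R)
    (est : R -> Omega -> R) : Prop :=
  forall t w, 0 <= t -> (exists v, is_argmax_ge0 (fun u => L u t w) v) ->
    is_argmax_ge0 (fun u => L u t w) (est t w).

End estimator.

(* Main.v *)
(* Solving the Doleans-Dade equation along each trajectory gives
     L_v(t) = exp (- v int_0^t phi dlds) prod_(T_n <= t) (1 + v phi(T_n)),
   which is log-concave in v as soon as phi >= 0; the latter is forced by P_v
   being a probability for every v >= 0. It is therefore enough that, for fixed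
   v <> theta, P_theta-a.s. L_v(t) < L_theta(t) for all large t: applied to
   v = theta (1 -+ 1/n) this traps the maximizer.

   The Hellinger affinity E_P sqrt(L_v L_theta)(t) is an exponential moment of a
   Poisson measure, namely exp (- int_0^t (sqrt(1 + v phi) - sqrt(1 + theta phi))^2 / 2 dlds),
   and the two limit hypotheses (the second one for j = 1) make it tend to 0. Hence
   there are events B_t in F_t with P_theta(~ B_t) and P_v(B_t) small. On B_t the
   ratio L_v / L_theta cannot reach 1/2 after t except with P_theta-probability
   at most 2 P_v(B_t): stopping at the first such time s, one has
   L_theta(s) <= 2 L_v(s), so the event costs at most twice as much under P_v. *)
Require Import Defs.
From HB Require Import structures.
From mathcomp Require Import all_boot all_order all_algebra.
From mathcomp Require Import all_classical all_reals all_analysis.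
From mathcomp Require Import measurable_realfun.
From mathcomp Require Import ring lra.

Set Implicit Arguments.
Unset Strict Implicit.
Unset Printing Implicit Defensive.

Import Order.TTheory GRing.Theory Num.Theory.
Import numFieldNormedType.Exports.

Local Open Scope classical_set_scope.
Local Open Scope ring_scope.

(** * Integrals over strips and a Volterra equation *)

(** Three obstacles shape the proof. The likelihood is known only as a solution of the Doleans-Dade
    equation, so its product form is a uniqueness statement; [phi] has no regularity, hence
    uniqueness between jumps cannot come from differentiation and rests on increments that are
    quadratic in a continuous variation function. The Poisson process is known only through its
    counts on sets of finite intensity, so exponential moments are reached from step functions by
    Fatou; this gives an upper bound, the direction that the affinity requires. Finally [phi >= 0]
    holds only almost everywhere, so positivity and square roots of likelihoods are confined to the
    full event that [phi >= 0] at every jump up to [t].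

    The affinity exponent is bounded through [(v - theta)^2 / 8 * (phi^2 - (v + theta) / 2 *
    phi^3)]: after integration the cubic term is negligible against the square, which is why [j = 1]
    is enough. The probabilities attached to the [B_t] need not be summable: the maximal inequality
    controls all later times at once, so the exceptional event is contained in events of arbitrarily
    small probability. *)

Lemma strip_measure {R : realType} (m : {measure set (measurableTypeR R) -> \bar R})
    (eta : probability (measurableTypeR R) R) (B : set (measurableTypeR R)) : measurable B ->
  (m \x eta)%E (B `*` setT) = m B.
Proof.
move=> mB; rewrite product_measure1E// -[RHS]mule1; congr (_ * _)%E.
exact: probability_setT.
Qed.

(** As [eta] has mass 1, the first projection carries [m \x eta] to [m]. The change of variables is
    applied to the positive and negative parts separately, so no integrability is asked for. *)
Lemma integral_fst {R : realType} (m : {measure set (measurableTypeR R) -> \bar R})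
    (eta : probability (measurableTypeR R) R) (D : set (measurableTypeR R))
    (f : measurableTypeR R -> \bar R) :
  measurable D -> measurable_fun D f ->
  (\int[m \x eta]_(p in D `*` setT) f p.1 = \int[m]_(x in D) f x)%E.
Proof.
move=> mD mf.
have mfst : measurable_fun setT
    (fst : measurableTypeR R * measurableTypeR R -> measurableTypeR R).
  exact: measurable_fst.
have pfE A : measurable A -> A `<=` D ->
    pushforward (m \x eta)%E fst A = m A.
  move=> mA _; rewrite /pushforward (_ : fst @^-1` A = A `*` setT); last first.
    by apply/seteqP; split => [p /=|p []].
  exact: strip_measure.
have DE : D `*` setT = fst @^-1` D :> set (measurableTypeR R * measurableTypeR R).
  by apply/seteqP; split => [p []|p /=].
have nonneg g : measurable_fun D g -> (forall x, 0 <= g x)%E ->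
    (\int[m \x eta]_(p in fst @^-1` D) (g \o fst) p = \int[m]_(x in D) g x)%E.
  move=> mg g0; rewrite -(ge0_integral_pushforward mfst)//.
  by apply: eq_measure_integral => A mA AD; exact: pfE.
rewrite integralE [RHS]integralE DE.
rewrite -(nonneg (f^\+)%E) ?funepos_ge0//; last exact: measurable_funepos.
rewrite -(nonneg (f^\-)%E)//; last exact: measurable_funeneg.
by rewrite -funepos_comp -funeneg_comp.
Qed.

Lemma Rintegral_fst {R : realType} (m : {measure set (measurableTypeR R) -> \bar R})
    (eta : probability (measurableTypeR R) R) (D : set (measurableTypeR R))
    (f : measurableTypeR R -> R) :
  measurable D -> measurable_fun D f ->
  \int[(m \x eta)%E]_(p in D `*` setT) f p.1 = \int[m]_(x in D) f x.
Proof.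
move=> mD mf; congr fine; apply: (integral_fst m eta mD (f := EFin \o f)).
exact/measurable_EFinP.
Qed.

(* Splitting [x, y] where V takes its middle value halves the constant C. *)
Lemma increment_square_bound_eq {R : realType} (V u : R -> R) (C a b : R) :
  a <= b -> continuous V -> {homo V : x y / x <= y} ->
  (forall x y, a <= x -> x <= y -> y <= b -> `|u y - u x| <= C * (V y - V x) ^+ 2) ->
  u b = u a.
Proof.
move=> ab cV ndV.
have halve D : 0 <= D ->
    (forall x y, a <= x -> x <= y -> y <= b -> `|u y - u x| <= D * (V y - V x) ^+ 2) ->
    (forall x y, a <= x -> x <= y -> y <= b ->
      `|u y - u x| <= D / 2 * (V y - V x) ^+ 2).
  move=> D0 uD x y ax xy yb.
  have [||c] := @IVT R V x y ((V x + V y) / 2) xy.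
  - exact: continuous_subspaceT.
  - rewrite minEle maxEle (ndV _ _ xy); have := ndV _ _ xy.
    by move=> ?; apply/andP; split; lra.
  rewrite in_itv/= => /andP[xc cy] Vc.
  have h1 := uD _ _ ax xc (le_trans cy yb).
  have h2 := uD _ _ (le_trans ax xc) cy yb.
  have -> : u y - u x = (u y - u c) + (u c - u x) by ring.
  apply: le_trans (ler_normD _ _) _; apply: le_trans (lerD h2 h1) _.
  by rewrite Vc le_eqVlt; apply/orP; left; apply/eqP; field.
move=> uC.
pose D := `|C|.
have uD x y : a <= x -> x <= y -> y <= b -> `|u y - u x| <= D * (V y - V x) ^+ 2.
  move=> *; apply: le_trans (uC _ _ _ _ _) _ => //.
  by rewrite ler_wpM2r ?sqr_ge0// ler_norm.
have key n : `|u b - u a| <= D / 2 ^+ n * (V b - V a) ^+ 2.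
  suff : forall x y, a <= x -> x <= y -> y <= b ->
      `|u y - u x| <= D / 2 ^+ n * (V y - V x) ^+ 2 by apply.
  elim: n => [|n IH]; first by rewrite expr0 divr1.
  rewrite exprSr invfM mulrA; apply: halve => //.
  by rewrite divr_ge0// ?normr_ge0// exprn_ge0.
apply/eqP; rewrite -subr_eq0 -normr_le0.
have : (D / 2 ^+ n * (V b - V a) ^+ 2) @[n --> \oo] --> (0 : R).
  rewrite -(mul0r ((V b - V a) ^+ 2)); apply: cvgMl.
  rewrite -(mulr0 D); apply: cvgMr.
  under eq_fun do rewrite -exprVn.
  by apply: cvg_expr; rewrite ger0_norm ?invr_ge0//; lra.
move=> /cvg_lim <-//; apply: limr_ge; last by near=> n.
apply/cvg_ex; exists 0; rewrite -(mul0r ((V b - V a) ^+ 2)); apply: cvgMl.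
rewrite -(mulr0 D); apply: cvgMr.
under eq_fun do rewrite -exprVn.
by apply: cvg_expr; rewrite ger0_norm ?invr_ge0//; lra.
Unshelve. all: by end_near. Qed.

Section cumulative.
Context {R : realType} (m : {measure set (measurableTypeR R) -> \bar R}).
Hypothesis atomless : forall t, m [set t] = 0%E.

(** Dominated convergence: the indicators of []-oo, u n]] converge to that of []-oo, t]] at every
    point except [t], which has no mass. This continuity feeds the halving argument above and,
    later, identifies left limits at jump times. *)
Lemma cumulative_continuous (B : set (measurableTypeR R)) (f : R -> R) :
  measurable B -> m.-integrable B (EFin \o f) ->
  continuous (fun t : R => \int[m]_(s in B `&` `]-oo, t]) f s).
Proof.
move=> mB fi t; apply/(@cvg_nbhsP _ R^o) => u ut.
have mf : measurable_fun B f by apply/measurable_EFinP; exact: (measurable_int m).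
have mr (x : R) : measurable_fun B (EFin \o (f \_ `]-oo, x])).
  apply/measurable_EFinP/(measurable_restrict f _ mB) => //.
  by apply: measurable_funS mf => //; exact: subIsetl.
have bnd (x s : R) : `|(f \_ `]-oo, x]) s| <= `|f s|.
  by rewrite patchE; case: ifP => // _; rewrite normr0.
have IE (x : R) := @Rintegral_mkcondr _ _ _ m B `]-oo, x] f.
rewrite [X in X @ _](_ : _ = fun n => \int[m]_(s in B) (f \_ `]-oo, u n]) s); last first.
  by apply/funext => n; exact: IE.
rewrite IE.
have ir (x : R) : m.-integrable B (EFin \o (f \_ `]-oo, x])).
  by apply: le_integrable fi => // s _; rewrite /= lee_fin bnd.
apply: fine_cvg; rewrite fineK; last exact: (integrable_fin_num mB (ir t)).
have [] // := @dominated_convergence _ _ R m B mB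
  (fun n => EFin \o (f \_ `]-oo, u n])) (EFin \o (f \_ `]-oo, t])) (fun s => `|f s|%:E) _ _ _ _ _.
- exists [set t]; split; [exact: measurable_set1|exact: atomless|].
  move=> s /= /not_implyP[Bs] ns.
  apply: contrapT => /eqP; rewrite neq_lt => st; apply: ns.
  apply: cvg_EFin; first by near=> n.
  apply: (@cvg_trans _ ((f \_ `]-oo, t]) s @[n --> \oo])); last exact: cvg_cst.
  have E (x : R) : (f \_ `]-oo, x]) s = if s <= x then f s else 0.
    by rewrite patchE mem_setE in_itv.
  apply: near_eq_cvg; case/orP: st => st.
    near=> n; rewrite /= !E (ltW st).
    suff -> : s <= u n by [].
    by near: n; apply: (cvgr_ge t).
  near=> n; rewrite /= !E (lt_geF st).
  suff /lt_geF -> : u n < s by [].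
  by near: n; apply: (cvgr_lt t).
- exact: (integrable_abse fi).
- by apply: aeW => s n _; rewrite lee_fin bnd.
Unshelve. all: by end_near. Qed.

End cumulative.

(** Everything follows from [1 + y <= exp y]: at [y = - x] it reads [(1 - x) exp x <= 1], that is
    [exp x - 1 - x <= x (exp x - 1)]. *)
Lemma expR_taylor2 {R : realType} (x : R) : `|expR x - 1 - x| <= x ^+ 2 * expR `|x|.
Proof.
have h1 : 0 <= expR x - 1 - x by have := expR_ge1Dx x; lra.
have h2 : expR x - 1 - x <= x * (expR x - 1).
  have h : (1 - x) * expR x <= 1.
    rewrite -[leRHS](expR0 R) -(addNr x) expRD ler_wpM2r ?expR_ge0//.
    exact: expR_ge1Dx.
  nra.
rewrite ger0_norm//; apply: le_trans h2 _.
have [x0|x0] := leP 0 x.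
  rewrite ger0_norm// expr2 -mulrA ler_wpM2l//.
  have : (1 - x) * expR x <= 1.
    rewrite -[leRHS](expR0 R) -(addNr x) expRD ler_wpM2r ?expR_ge0//.
    exact: expR_ge1Dx.
  by nra.
rewrite ltr0_norm//.
have e1 : 1 <= expR (- x) by rewrite -expR0 ler_expR oppr_ge0 ltW.
have := expR_ge1Dx x; have := expR_gt0 x => *.
apply: (@le_trans _ _ (x ^+ 2)); first by rewrite expr2; nra.
by rewrite ler_peMr// sqr_ge0.
Qed.

Section volterra.
Context {R : realType} (m : {measure set (measurableTypeR R) -> \bar R}).

Lemma Rintegral_oc_cat (f : R -> R) (a b c : R) : a <= b -> b <= c ->
  m.-integrable `]a, c] (EFin \o f) ->
  \int[m]_(s in `]a, c]) f s =
  \int[m]_(s in `]a, b]) f s + \int[m]_(s in `]b, c]) f s.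
Proof.
move=> ab bc fi.
have E : `]a, c]%classic = `]a, b] `|` `]b, c] :> set (measurableTypeR R).
  by rewrite -itv_bndbnd_setU// bnd_simp.
rewrite E Rintegral_setU//; first by rewrite -E.
apply/disj_setPS => y [/=]; rewrite 2!in_itv/= => /andP[_ yx] /andP[].
by rewrite ltNge yx.
Qed.

Lemma integrable_bounded_mul (D : set (measurableTypeR R)) (f g : R -> R) (M : R) :
  measurable D -> measurable_fun D g -> (forall s, D s -> `|g s| <= M) ->
  m.-integrable D (EFin \o f) -> m.-integrable D (EFin \o (fun s => g s * f s)).
Proof.
move=> mD mg gM fi.
have mf : measurable_fun D f by apply/measurable_EFinP; exact: (measurable_int m).
apply: (@le_integrable _ _ _ m _ mD _ (fun s => (M * f s)%:E)).
- by apply/measurable_EFinP; exact: measurable_funM.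
- move=> s Ds; rewrite /= lee_fin !normrM ler_wpM2r//.
  by rewrite (le_trans (gM _ Ds))// ler_norm.
- exact: (integrableZl mD M fi).
Qed.

Hypothesis atomless : forall t, m [set t] = 0%E.

(** With [Psi] the primitive of [psi], the function [u = y exp Psi] is formally constant. Since
    [psi] is only integrable, its increments are instead bounded by a constant times the squared
    increment of [V], the primitive of [|psi|], and [increment_square_bound_eq] concludes. *)
Lemma volterra_expR (psi y yl : R -> R) (a b M : R) : a <= b ->
  m.-integrable `]a, b] (EFin \o psi) ->
  measurable_fun (`]a, b] : set (measurableTypeR R)) yl ->
  (forall s, a < s <= b -> `|yl s| <= M) ->
  (forall s, a < s <= b -> y x @[x --> s^'-] --> yl s) ->
  (forall t, a <= t <= b ->
    y t = y a - \int[m]_(s in `]a, t]) (yl s * psi s)) ->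
  y b = y a * expR (- \int[m]_(s in `]a, b]) psi s).
Proof.
move=> ab ipsi myl ylM ycvg yE.
have M0 : a < b -> 0 <= M.
  by move=> lab; apply: le_trans (ylM b _) => //; rewrite lab lexx.
(* Intersecting with []a, b]] defines the primitives on all of R, where [increment_square_bound_eq]
   wants [V] continuous and monotone. *)
pose I (f : R -> R) (t : R) := \int[m]_(s in `]a, b] `&` `]-oo, t]) f s.
have IE f t : a <= t <= b -> I f t = \int[m]_(s in `]a, t]) f s.
  move=> /andP[at_ tb]; rewrite /I; congr (Rintegral m _ _).
  apply/seteqP; split => s /=; rewrite !in_itv/=.
    by move=> [/andP[-> _] ->].
  by move=> /andP[-> st]; rewrite st (le_trans st).
have ipsiS x t : a <= x -> t <= b -> m.-integrable `]x, t] (EFin \o psi).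
  move=> ax tb; apply: integrableS ipsi => //.
  move=> s /=; rewrite !in_itv/= => /andP[xs st].
  by rewrite (le_lt_trans ax xs) (le_trans st tb).
have iabs : m.-integrable `]a, b] (EFin \o (fun s => `|psi s|)).
  exact: (integrable_norm ipsi).
have iabsS x t : a <= x -> t <= b -> m.-integrable `]x, t] (EFin \o (fun s => `|psi s|)).
  by move=> ax tb; exact: (integrable_norm (ipsiS _ _ ax tb)).
pose V := I (fun s => `|psi s|).
pose Psi := I psi.
have VB x t : a <= x -> x <= t -> t <= b ->
    V t - V x = \int[m]_(s in `]x, t]) `|psi s|.
  move=> ax xt tb; rewrite /V !IE ?ax ?tb ?(le_trans ax)// ?(le_trans xt)//.
  by rewrite (Rintegral_oc_cat ax xt) ?iabsS//; ring.
have PB x t : a <= x -> x <= t -> t <= b ->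
    Psi t - Psi x = \int[m]_(s in `]x, t]) psi s.
  move=> ax xt tb; rewrite /Psi !IE ?ax ?tb ?(le_trans ax)// ?(le_trans xt)//.
  by rewrite (Rintegral_oc_cat ax xt) ?ipsiS//; ring.
have iyl x t : a <= x -> t <= b ->
    m.-integrable `]x, t] (EFin \o (fun s => yl s * psi s)).
  move=> ax tb.
  have sub : (`]x, t] : set (measurableTypeR R)) `<=` `]a, b].
    move=> s /=; rewrite !in_itv/= => /andP[xs st].
    by rewrite (le_lt_trans ax xs) (le_trans st tb).
  apply: (@integrable_bounded_mul _ _ _ M) => //; last exact: ipsiS.
    exact: measurable_funS myl.
  by move=> s /sub; rewrite /= in_itv; exact: ylM.
have yB x t : a <= x -> x <= t -> t <= b ->
    y t - y x = - \int[m]_(s in `]x, t]) (yl s * psi s).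
  move=> ax xt tb; rewrite (yE t) ?tb ?(le_trans ax)// (yE x) ?ax ?(le_trans xt)//.
  by rewrite (Rintegral_oc_cat ax xt) ?iyl//; ring.
have Vge x t : a <= x -> x <= t -> t <= b -> 0 <= V t - V x.
  by move=> ax xt tb; rewrite VB//; apply: Rintegral_ge0.
have ndV : {homo V : x t / x <= t}.
  move=> x t xt; rewrite /V /I.
  set A := _ `&` `]-oo, x]; set B := _ `&` `]-oo, t].
  have AB : A `<=` B.
    by move=> s; rewrite /A /B /= !in_itv/= => -[-> sx]; rewrite (le_trans sx xt).
  have mA : measurable (A : set (measurableTypeR R)) by exact: measurableI.
  have mB : measurable (B : set (measurableTypeR R)) by exact: measurableI.
  have iB : m.-integrable B (EFin \o (fun s => `|psi s|)).
    by apply: integrableS iabs => //; exact: subIsetl.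
  rewrite /Rintegral fine_le//.
  - by apply: integrable_fin_num => //; exact: integrableS iB.
  - exact: integrable_fin_num.
  - by apply: ge0_subset_integral => //; exact: (measurable_int m).
have cV : continuous V by apply: cumulative_continuous.
have dPV x t : a <= x -> x <= t -> t <= b -> `|Psi t - Psi x| <= V t - V x.
  by move=> ax xt tb; rewrite PB// VB//; apply: le_normr_Rintegral => //; exact: ipsiS.
have int_le (g : R -> R) e x t : a <= x -> x <= t -> t <= b ->
    measurable_fun (`]x, t] : set (measurableTypeR R)) g ->
    (forall s, x < s <= t -> `|g s| <= e) ->
    `|\int[m]_(s in `]x, t]) (g s * psi s)| <= e * (V t - V x).
  move=> ax xt tb mg ge.
  have ige : m.-integrable `]x, t] (EFin \o (fun s => g s * psi s)).
    by apply: (@integrable_bounded_mul _ _ _ e) => //; exact: ipsiS.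
  apply: le_trans (le_normr_Rintegral _ ige) _ => //.
  rewrite VB// -RintegralZl// ?iabsS//; apply: le_Rintegral => //.
  - exact: (integrable_norm ige).
  - exact: (integrableZl _ e (iabsS _ _ ax tb)).
  - move=> s; rewrite /= in_itv/= => xst; rewrite normrM ler_wpM2r//.
    exact: ge.
have mylS x t : a <= x -> t <= b -> measurable_fun (`]x, t] : set (measurableTypeR R)) yl.
  move=> ax tb; apply: measurable_funS myl => //.
  move=> s /=; rewrite !in_itv/= => /andP[xs st].
  by rewrite (le_lt_trans ax xs) (le_trans st tb).
have dy x t : a <= x -> x <= t -> t <= b -> `|y t - y x| <= M * (V t - V x).
  move=> ax xt tb; rewrite yB// normrN; apply: int_le => //; first exact: mylS.
  by move=> s /andP[xs st]; apply: ylM; rewrite (le_lt_trans ax xs) (le_trans st tb).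
have dyl x s : a <= x -> x < s -> s <= b -> `|yl s - y x| <= M * (V s - V x).
  move=> ax xs sb.
  have ys : `|y r - y x| @[r --> s^'-] --> `|yl s - y x|.
    apply: cvg_norm; apply: cvgB; last exact: cvg_cst.
    by apply: ycvg; rewrite sb (le_lt_trans ax xs).
  apply: (cvgr_to_le ys); near=> r.
  have xr : x <= r by apply: ltW; near: r; exact: nbhs_left_gt.
  have rs : r <= s by near: r; exact: nbhs_left_le.
  apply: le_trans (dy _ _ ax xr (le_trans rs sb)) _.
  rewrite ler_wpM2l ?M0 ?(le_lt_trans ax (lt_le_trans xs sb))//.
  by rewrite lerD2r; exact: ndV.
(* First-order expansion of [y]: freezing [yl s] at [y x] under the integral costs at most
   [M * (V t - V x)] by [dyl], hence a quadratic error once integrated. *)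
have dy2 x t : a <= x -> x <= t -> t <= b ->
    `|y t - y x + y x * (Psi t - Psi x)| <= M * (V t - V x) ^+ 2.
  move=> ax xt tb.
  have -> : y t - y x + y x * (Psi t - Psi x) =
      - \int[m]_(s in `]x, t]) ((yl s - y x) * psi s).
    under eq_Rintegral do rewrite mulrBl.
    rewrite RintegralB ?iyl//; last exact: (integrableZl _ (y x) (ipsiS _ _ ax tb)).
    by rewrite RintegralZl ?ipsiS// yB// PB//; ring.
  rewrite normrN expr2 mulrA; apply: int_le => //.
    apply: measurable_funB; [exact: mylS|exact: measurable_cst].
  move=> s /andP[xs st]; apply: le_trans (dyl _ _ ax xs (le_trans st tb)) _.
  have ab' : a < b by rewrite (le_lt_trans ax)// (lt_le_trans xs)// (le_trans st tb).
  by rewrite ler_wpM2l ?M0// lerD2r; exact: ndV.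
have Va : V a = 0.
  by rewrite /V IE ?lexx// set_itv_ge ?bnd_simp ?ltxx// Rintegral_set0.
have Pa : Psi a = 0.
  by rewrite /Psi IE ?lexx// set_itv_ge ?bnd_simp ?ltxx// Rintegral_set0.
pose W := V b.
have VW t : a <= t -> t <= b -> 0 <= V t <= W.
  by move=> at_ tb; rewrite -{1}Va !ndV.
have [->|ab'] := eqVneq a b.
  by rewrite set_itv_ge ?bnd_simp ?ltxx// Rintegral_set0 oppr0 expR0 mulr1.
have {ab'}ltab : a < b by rewrite lt_neqAle ab'.
have M00 := M0 ltab.
pose Bd := `|y a| + M * W.
have yBd t : a <= t -> t <= b -> `|y t| <= Bd.
  move=> at_ tb; have -> : y t = y a + (y t - y a) by ring.
  rewrite (le_trans (ler_normD _ _))// lerD2l (le_trans (dy _ _ _ _ _))//.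
  by rewrite ler_wpM2l// Va subr0; have /andP[] := VW _ at_ tb.
pose u t := y t * expR (Psi t).
suff : u b = u a.
  rewrite /u Pa expR0 mulr1 => <-; rewrite -mulrA -expRD.
  by rewrite /Psi IE ?ab ?lexx// addrN expR0 mulr1.
(* The inner summands bound, in order, the three terms of the decomposition below: the Taylor
   remainder of exp at [D], the expansion [dy2], and a product of two first-order increments. The
   outer [expR W] bounds [expR (Psi x)]. *)
apply: (@increment_square_bound_eq _ V u ((Bd * expR W + M + M) * expR W)) => //.
move=> x t ax xt tb.
set D := Psi t - Psi x; set E := V t - V x.
have E0 : 0 <= E by apply: Vge.
have DE : `|D| <= E by apply: dPV.
have D2 : D ^+ 2 <= E ^+ 2 by rewrite -(real_normK (num_real D)) lerXn2r ?nnegrE.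
have EW : E <= W.
  have /andP[h1 h2] := VW _ ax (le_trans xt tb).
  have /andP[h3 h4] := VW _ (le_trans ax xt) tb.
  by rewrite /E; lra.
have -> : u t - u x = (y t * (expR D - 1 - D) + (y t - y x + y x * D) + (y t - y x) * D) * expR (Psi x).
  have -> : u t = y t * (expR D * expR (Psi x)) by rewrite -expRD /D subrK.
  by rewrite /u; ring.
rewrite normrM (ger0_norm (expR_ge0 _)) mulrAC.
apply: ler_pM => //; last first.
  rewrite ler_expR; apply: le_trans (ler_norm _) _.
  have := dPV _ _ (lexx a) ax (le_trans xt tb); rewrite Pa Va !subr0 => /le_trans; apply.
  by have /andP[] := VW _ ax (le_trans xt tb).
apply: le_trans (ler_normD _ _) _; 
rewrite [leRHS](_ : _ = Bd * expR W * E ^+ 2 + M * E ^+ 2 + M * E ^+ 2); last by ring.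
apply: lerD; last first.
  rewrite normrM expr2 mulrA; apply: ler_pM => //; exact: dy.
apply: le_trans (ler_normD _ _) _; apply: lerD; last exact: dy2.
rewrite normrM -mulrA; apply: ler_pM => //; first exact: yBd (le_trans ax xt) tb.
apply: le_trans (expR_taylor2 D) _; rewrite mulrC; apply: ler_pM => //.
  exact: sqr_ge0.
by rewrite ler_expR (le_trans DE).
Unshelve. all: by end_near. Qed.

End volterra.

(** * Cadlag functions and jump sums *)

Section cadlag_functions.
Context {R : realType}.
Implicit Types Y : R -> R.

Lemma left_limit_cvg Y t : cadlag Y -> 0 < t -> Y x @[x --> t^'-] --> left_limit Y t.
Proof. by move=> [_ /[apply]]. Qed.

(** One-sided limits give local bounds, and compactness of [[0, t]] makes them uniform. The guard
    [0 <= x'] makes the left side of 0 vacuous, where [cadlag] says nothing. *)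
Lemma cadlag_bounded Y (t : R) : cadlag Y ->
  exists M, forall s, 0 <= s <= t -> `|Y s| <= M.
Proof.
move=> cY.
have near_bounded (x : R) : 0 <= x -> exists K : R, \forall x' \near x, 0 <= x' -> `|Y x'| <= K.
  move=> x0; have [/(_ _ x0) + _] := cY => /cvgrPdist_lt/(_ 1 ltr01) rY.
  have lY : exists l : R, \forall x' \near x^'-, 0 <= x' -> `|Y x'| <= `|l| + 1.
    have [x0'|] := ltP 0 x.
      exists (left_limit Y x).
      have /cvgrPdist_lt/(_ 1 ltr01) := left_limit_cvg cY x0'.
      apply: filterS => z /ltW h _; rewrite -lerBlDl.
      by rewrite (le_trans (lerB_dist _ _))// distrC.
    move=> x0'; exists 0; near=> z => z0.
    have : z < x by near: z; exact: nbhs_left_lt.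
    by move=> zx; have := le_lt_trans z0 (lt_le_trans zx x0'); rewrite ltxx.
  have [l {}lY] := lY.
  exists (Num.max (`|l| + 1) (`|Y x| + 1)).
  move: rY lY; rewrite /at_right /at_left !near_withinE => rY lY.
  near=> z => z0.
  have [zx|xz|->] := ltgtP z x.
  - rewrite le_max; apply/orP; left; move: z0; move: zx.
    by near: z.
  - rewrite le_max; apply/orP; right.
    have /ltW h : `|Y x - Y z| < 1 by move: xz; near: z.
    by rewrite -lerBlDl (le_trans (lerB_dist _ _))// distrC.
  - by rewrite le_max lerDl ler01 orbT.
have /compact_near_coveringP cov := @segment_compact R 0 t.
have := cov R (pinfty_nbhs R) (fun M x => 0 <= x -> `|Y x| <= M) _ _.
case.
  move=> x /=; rewrite in_itv/= => /andP[x0 _]; have [K nK] := near_bounded x x0.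
  near=> z M => /= z0; apply: (@le_trans _ _ K).
    by move: z0; near: z.
  by near: M; apply: nbhs_pinfty_ge; exact: num_real.
move=> M [_ /(_ (M + 1))]; rewrite ltrDl ltr01 => /(_ isT) h.
by exists (M + 1) => s s0t; apply: h; rewrite ?in_itv//=; case/andP: s0t.
Unshelve. all: by end_near. Qed.

Lemma left_limit_bounded Y (t M : R) : cadlag Y ->
  (forall s, 0 <= s <= t -> `|Y s| <= M) ->
  forall s, 0 < s <= t -> `|left_limit Y s| <= M.
Proof.
move=> cY YM s /andP[s0 st].
apply: (cvgr_to_le (cvg_norm (left_limit_cvg cY s0))); near=> z; apply: YM.
apply/andP; split; first by apply: ltW; near: z; exact: nbhs_left_gt.
by apply: le_trans st; near: z; exact: nbhs_left_le.
Unshelve. all: by end_near. Qed.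

(* left_limit Y is the pointwise limit of the step functions
   s |-> Y ((ceil (n s) - 1) / n), sampled strictly to the left of s. *)
Lemma left_limit_measurable Y : cadlag Y ->
  measurable_fun (`]0, +oo[ : set (measurableTypeR R)) (left_limit Y).
Proof.
move=> cY.
pose c (n : nat) (s : R) : R := (Num.ceil (s * n.+1%:R) - 1)%:~R / n.+1%:R.
have n0 n : 0 < n.+1%:R :> R by rewrite ltr0n.
have c_lt n s : c n s < s.
  by rewrite ltr_pdivrMr//; have /andP[] := ceil_itv (s * n.+1%:R).
have c_ge n s : s - n.+1%:R^-1 <= c n s.
  rewrite ler_pdivlMr// mulrBl mulVf ?gt_eqF// intrB lerD2r.
  by have /andP[] := ceil_itv (s * n.+1%:R).
apply: (@measurable_fun_cvg _ _ _ _ (fun n s => Y (c n s))).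
  move=> n.
  have -> : (`]0, +oo[%classic : set (measurableTypeR R)) =
      \bigcup_k `](k%:R / n.+1%:R), (k.+1%:R / n.+1%:R)]%classic.
    apply/seteqP; split => s /=; rewrite in_itv/= ?andbT.
      move=> s0; have : (0 < Num.ceil (s * n.+1%:R))%R by rewrite ceil_gt0 mulr_gt0.
      case E : (Num.ceil _) => [[|k]|k]// _.
      exists k => //=; rewrite in_itv/= ltr_pdivrMr// ler_pdivlMr//.
      have := ceil_itv (s * n.+1%:R); rewrite E.
      by rewrite (_ : k.+1%:Z - 1 = k%:Z)// -addn1 PoszD addrK.
    move=> [k _]; rewrite /= in_itv/= => /andP[+ _]; apply: le_lt_trans.
    by rewrite divr_ge0.
  apply/measurable_fun_bigcup => // k.
  apply: (@eq_measurable_fun _ _ _ _ _ (cst (Y (k%:R / n.+1%:R)))); last exact: measurable_cst.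
  move=> s; rewrite inE/= in_itv/= ltr_pdivrMr// ler_pdivlMr// => ks.
  rewrite /c (@ceil_def _ _ k.+1%:Z); last first.
    by rewrite (_ : k.+1%:Z - 1 = k%:Z)// -addn1 PoszD addrK.
  by rewrite (_ : k.+1%:Z - 1 = k%:Z)// -addn1 PoszD addrK.
move=> s /=; rewrite in_itv/= andbT => s0.
have /cvg_at_leftP := left_limit_cvg cY s0; apply; split => //.
apply: (@squeeze_cvgr _ _ _ _ (fun n => s - n.+1%:R^-1) (cst s)).
- by near=> n; rewrite c_ge ltW.
- rewrite -[X in _ --> X]subr0; apply: cvgB; first exact: cvg_cst.
  exact: cvg_harmonic.
- exact: cvg_cst.
Unshelve. all: by end_near. Qed.

End cadlag_functions.
(** [N] is the first index whose jump comes after [t]. This form turns integrals against the jump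
    measure over []0, t]] into sums over [n < N]. *)
Lemma jump_count_exists {R : realType} (tau : nat -> R) (t : R) :
  (forall n, tau n < tau n.+1) -> tau n @[n --> \oo] --> +oo ->
  exists N, forall n, (tau n <= t) = (n < N)%N.
Proof.
move=> inc /cvgryPgt/(_ t) [N0 _ hN0].
have ex : exists n, t < tau n by exists N0; exact: hN0 N0 (leqnn _).
have mono : {homo tau : i j / (i <= j)%N >-> i <= j}.
  by apply: homo_leq => // [y x z|i]; [exact: le_trans|exact: ltW].
exists (ex_minn ex); case: ex_minnP => N tN minN n.
rewrite leNgt ltnNge; congr (~~ _); apply/idP/idP => [|Nn]; first exact: minN.
exact: lt_le_trans tN (mono _ _ Nn).
Qed.

Section jumps.
Context d (Omega : measurableType d) (R : realType).
Local Notation RE := (measurableTypeR R * measurableTypeR R)%type.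
Variables (T Z : nat -> Omega -> R) (w : Omega) (t : R) (N : nat).
Hypothesis T_gt0 : forall n, 0 < T n w.
Hypothesis countN : forall n, (T n w <= t) = (n < N)%N.

Let strip : set RE := `]0, t] `*` setT.

Let in_strip n : (((T n w, Z n w) : RE) \in strip) = (n < N)%N.
Proof.
rewrite -countN; apply/idP/idP; rewrite inE /strip /= in_itv/= T_gt0/=.
  by case.
by move=> ->.
Qed.

Lemma nneseries_finite (f : nat -> \bar R) (n : nat) : (forall k, 0 <= f k)%E ->
  (forall k, (n <= k)%N -> f k = 0%E) ->
  (\sum_(k <oo) f k = \sum_(k < n) f k)%E.
Proof.
move=> f0 fn; rewrite (nneseries_split 0 n)// add0n big_mkord.
rewrite [X in (_ + X)%E](_ : _ = 0%E) ?adde0//.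
by rewrite eseries0// => k nk _; exact: fn.
Qed.

Lemma jump_measureE (A : set RE) : A `<=` `]0, t] `*` setT ->
  jump_measure T Z w A = (\sum_(n < N) \1_A ((T n w, Z n w) : RE))%:E.
Proof.
move=> At; rewrite /jump_measure /mseries (@nneseries_finite _ N).
- by rewrite -sumEFin; apply: eq_bigr => k _.
- by move=> k.
- move=> k Nk; rewrite /= diracE; case: (boolP (_ \in _)) => // /set_mem/At/mem_set.
  by rewrite (in_strip k) ltnNge Nk.
Qed.

Lemma ge0_jump_integral (g : RE -> \bar R) :
  measurable_fun (`]0, t] `*` setT : set RE) g -> (forall p, 0 <= g p)%E ->
  (\int[jump_measure T Z w]_(p in `]0%R, t] `*` setT) g p =
   \sum_(n < N) g (T n w, Z n w))%E.
Proof.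
move=> mg g0; rewrite ge0_integral_measure_series//; last first.
  by apply: measurableX.
rewrite (@nneseries_finite _ N).
- apply: eq_bigr => k _; rewrite integral_dirac//; last exact: measurableX.
  by rewrite diracE in_strip ltn_ord mul1e.
- by move=> k; exact: integral_ge0.
- move=> k Nk; rewrite integral_dirac//; last exact: measurableX.
  by rewrite diracE in_strip ltnNge Nk mul0e.
Qed.

Lemma jump_Rintegral (H : RE -> R) :
  measurable_fun (`]0, t] `*` setT : set RE) H ->
  \int[jump_measure T Z w]_(p in `]0, t] `*` setT) H p =
  \sum_(n < N) H (T n w, Z n w).
Proof.
move=> mH; rewrite /Rintegral integralE.
have mH' : measurable_fun (`]0, t] `*` setT : set RE) (EFin \o H) by exact/measurable_EFinP.
rewrite ge0_jump_integral//; last exact: measurable_funepos.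
rewrite ge0_jump_integral//; last exact: measurable_funeneg.
under eq_bigr do rewrite funeposE -EFin_max.
under [X in (_ - X)%E]eq_bigr do rewrite funenegE -EFinN -EFin_max.
rewrite !sumEFin -EFinB/= -sumrB; apply: eq_bigr => k _.
by rewrite !maxEle; case: (leP (H _) 0) => h1; case: (leP (- H _) 0) => h2; lra.
Qed.

End jumps.

(** * Pathwise solution of the Doleans-Dade equation *)

Section segment.
Context {R : realType} (m : {measure set (measurableTypeR R) -> \bar R}).
Hypothesis atomless : forall t, m [set t] = 0%E.
Variables (tau : nat -> R) (psi Y : R -> R).
Hypothesis tau_gt0 : forall n, 0 < tau n.
Hypothesis tau_inc : forall n, tau n < tau n.+1.
Hypothesis ipsi : forall t : R, 0 < t -> m.-integrable `]0, t] (EFin \o psi).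
Hypothesis cY : cadlag Y.
Hypothesis YE : forall (t : R) (N : nat), 0 <= t -> (forall n, (tau n <= t) = (n < N)%N) ->
  Y t = 1 + \sum_(n < N) left_limit Y (tau n) * psi (tau n)
        - \int[m]_(s in `]0, t]) (left_limit Y s * psi s).

Let yl := left_limit Y.

Let integrable_yl (t : R) : 0 < t -> m.-integrable `]0, t] (EFin \o (fun s => yl s * psi s)).
Proof.
move=> t0; have [M YM] := cadlag_bounded t cY.
apply: (@integrable_bounded_mul _ _ _ _ _ M) => //; last exact: ipsi.
  apply: measurable_funS (left_limit_measurable cY) => //.
  by move=> s /=; rewrite !in_itv/= andbT => /andP[].
by move=> s; rewrite /= in_itv/=; exact: left_limit_bounded.
Qed.

(** No jump lies in []a, b[], so the equation is there of Volterra type. A jump at [b] adds the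
    single term [yl b * psi b], whence the factor [1 + psi b]. *)
Let segment (a b : R) (k : nat) : 0 <= a -> a < b -> (forall n, (tau n <= a) = (n < k)%N) ->
  (forall n, (tau n < b) = (n < k)%N) ->
  (forall t : R, a <= t -> t < b -> Y t = Y a * expR (- \int[m]_(s in `]a, t]) psi s)) /\
  yl b = Y a * expR (- \int[m]_(s in `]a, b]) psi s) /\
  (tau k = b -> Y b = yl b * (1 + psi b)).
Proof.
move=> a0 ab ka kb.
have b0 : 0 < b by exact: le_lt_trans ab.
have [M YM] := cadlag_bounded b cY.
have sub (x t : R) : 0 <= x -> t <= b ->
    (`]x, t]%classic : set (measurableTypeR R)) `<=` `]0, b].
  move=> x0 tb s /=; rewrite !in_itv/= => /andP[xs st].
  by rewrite (le_lt_trans x0 xs) (le_trans st tb).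
have iyl (x t : R) : 0 <= x -> t <= b -> m.-integrable `]x, t] (EFin \o (fun s => yl s * psi s)).
  by move=> x0 tb; apply: integrableS (integrable_yl b0) => //; exact: sub.
have ip (x t : R) : 0 <= x -> t <= b -> m.-integrable `]x, t] (EFin \o psi).
  by move=> x0 tb; apply: integrableS (ipsi b0) => //; exact: sub.
(* [y] prolongs the jump-free equation up to [b] included: it equals [Y] before [b] but ignores a
   jump at [b]. *)
pose y (t : R) := Y a - \int[m]_(s in `]a, t]) (yl s * psi s).
have ya : y a = Y a.
  by rewrite /y set_itv_ge ?bnd_simp ?ltxx// Rintegral_set0 subr0.
have Yy (t : R) : a <= t -> t < b -> Y t = y t.
  move=> at_ tb; have kt n : (tau n <= t) = (n < k)%N.
    apply/idP/idP => [nt|]; first by rewrite -kb (le_lt_trans nt).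
    by rewrite -ka => /le_trans; exact.
  rewrite /y (YE (le_trans a0 at_) kt) (YE a0 ka).
  by rewrite -/yl (Rintegral_oc_cat a0 at_ (iyl _ _ (lexx 0) (ltW tb))) opprD addrA.

have ycvg (s : R) : a < s <= b -> y x @[x --> s^'-] --> yl s.
  move=> /andP[as_ sb].
  have s0 : 0 < s by exact: le_lt_trans as_.
  apply: cvg_trans (left_limit_cvg cY s0); apply: near_eq_cvg; near=> x.
  apply: Yy; first by apply: ltW; near: x; exact: nbhs_left_gt.
  by apply: lt_le_trans sb; near: x; exact: nbhs_left_lt.
have volt (t : R) : a <= t -> t <= b -> y t = Y a * expR (- \int[m]_(s in `]a, t]) psi s).
  move=> at_ tb; rewrite -ya.
  apply: (@volterra_expR _ m atomless psi y yl a t M) => //.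
  - exact: ip.
  - apply: measurable_funS (left_limit_measurable cY) => //.
    move=> s /=; rewrite !in_itv/= andbT => /andP[as_ _].
    exact: le_lt_trans as_.
  - move=> s /andP[as_ st]; apply: (left_limit_bounded cY YM).
    by rewrite (le_lt_trans a0 as_) (le_trans st tb).
  - by move=> s /andP[as_ st]; apply: ycvg; rewrite as_ (le_trans st tb).
  - by move=> s _; rewrite ya.
(* [Y] and [y] have the same left limit at [b], and [y] is left-continuous there because [m] has no
   atom. *)
have ylb : yl b = y b.
  have h1 : y x @[x --> b^'-] --> yl b by apply: ycvg; rewrite ab lexx.
  suff h2 : y x @[x --> b^'-] --> y b.
    by apply: (cvg_unique _ h1 h2); exact: norm_hausdorff.
  pose I (t : R) := \int[m]_(s in `]a, b] `&` `]-oo, t]) (yl s * psi s).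
  have IE (t : R) : a <= t -> t <= b -> I t = \int[m]_(s in `]a, t]) (yl s * psi s).
    move=> at_ tb; rewrite /I; congr (Rintegral m _ _).
    apply/seteqP; split => s /=; rewrite !in_itv/=.
      by move=> [/andP[-> _] ->].
    by move=> /andP[-> st]; rewrite st (le_trans st).
  have cI : I x @[x --> b^'-] --> I b.
    apply: cvg_at_left_filter.
    by apply: (cumulative_continuous atomless) => //; exact: iyl.
  rewrite /y -(IE b (ltW ab) (lexx b)).
  apply: cvg_trans (cvgB (cvg_cst (Y a)) cI); apply: near_eq_cvg.
  near=> x.
  have ax : a <= x by apply: ltW; near: x; exact: nbhs_left_gt.
  have xb : x <= b by near: x; exact: nbhs_left_le.
  by rewrite /y -(IE x ax xb).
split; first by move=> t at_ tb; rewrite Yy// volt// ltW.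
split; first by rewrite ylb volt// ltW.
move=> kb'.
have kSb n : (tau n <= b) = (n < k.+1)%N.
  have mono : {homo tau : i j / (i <= j)%N >-> i <= j}.
    by apply: homo_leq => // [y' x z|i]; [exact: le_trans|exact: ltW].
  rewrite ltnS; apply/idP/idP => [|nk]; last by rewrite -kb' mono.
  rewrite leqNgt; apply: contraTN => kn; rewrite -ltNge -kb'.
  exact: lt_le_trans (tau_inc k) (mono _ _ kn).
have E := YE a0 ka; rewrite -/yl in E.
rewrite (YE (ltW b0) kSb) big_ord_recr/= -/yl kb'.
rewrite (Rintegral_oc_cat a0 (ltW ab) (iyl _ _ (lexx 0) (lexx b))).
rewrite mulrDr mulr1 [in X in _ = X + _]ylb /y E.
by rewrite opprD !addrA [RHS]addrAC; congr (_ - _); rewrite [RHS]addrAC.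
Unshelve. all: by end_near. Qed.

(** Induction over the jump times: [segment] carries the formula from each jump to the next, and
    finally from the last jump before or at [t] to [t] itself. *)
Lemma jump_volterra_product (k : nat) : forall t : R, 0 <= t -> (forall n, (tau n <= t) = (n < k)%N) ->
  Y t = expR (- \int[m]_(s in `]0, t]) psi s) * \prod_(n < k) (1 + psi (tau n)).
Proof.
have mono : {homo tau : i j / (i <= j)%N >-> i <= j}.
  by apply: homo_leq => // [y' x z|i]; [exact: le_trans|exact: ltW].
have smono : {mono tau : i j / (i <= j)%N >-> i <= j}.
  move=> i j; apply/idP/idP => [|/mono//]; apply: contraTT; rewrite -ltnNge -ltNge => ji.
  exact: lt_le_trans (tau_inc j) (mono _ _ ji).
have count_tau j n : (tau n <= tau j) = (n < j.+1)%N by rewrite smono ltnS.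
have scount_tau j n : (tau n < tau j) = (n < j)%N by rewrite ltNge smono -ltnNge.
have glue (a t : R) : 0 <= a -> a <= t -> 0 < t ->
    expR (- \int[m]_(s in `]0, a]) psi s) * expR (- \int[m]_(s in `]a, t]) psi s) =
    expR (- \int[m]_(s in `]0, t]) psi s).
  move=> a0 at_ t0; rewrite -expRD -opprD -(Rintegral_oc_cat a0 at_)//.
  exact: ipsi.
have I00 : \int[m]_(s in `]0, 0]) psi s = 0.
  by rewrite set_itv_ge ?bnd_simp ?ltxx// Rintegral_set0.
have Y0 : Y 0 = 1.
  rewrite (@YE 0 0)// ?big_ord0 ?set_itv_ge ?bnd_simp ?ltxx// ?Rintegral_set0.
    by rewrite subr0 addr0.
  by move=> n; rewrite leNgt tau_gt0.
(* the value at the k-th jump, or at time 0 when k = 0 *)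
have at_jump j : Y (if j is i.+1 then tau i else 0) =
    expR (- \int[m]_(s in `]0, (if j is i.+1 then tau i else 0)]) psi s) *
    \prod_(n < j) (1 + psi (tau n)).
  elim: j => [|j IH].
    by rewrite Y0 big_ord0 I00 oppr0 expR0 mulr1.
  set a := (if j is i.+1 then tau i else 0) in IH.
  have a0 : 0 <= a by rewrite /a; case: (j) => // i; exact: ltW.
  have aj : a < tau j by rewrite /a; case: (j) => // i.
  have ca n : (tau n <= a) = (n < j)%N.
    by rewrite /a; case: (j) => [|i]; [rewrite leNgt tau_gt0|exact: count_tau].
  have [_ [ylE jmp]] := segment a0 aj ca (scount_tau j).
  rewrite jmp// ylE IH big_ord_recr/= -(glue a (tau j) a0 (ltW aj) (tau_gt0 j)).
  by rewrite [RHS]mulrA; congr (_ * _); rewrite mulrAC.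
move=> t t0 ct.
have := at_jump k; set a := (if k is i.+1 then tau i else 0) => Ya.
have a0 : 0 <= a by rewrite /a; case: (k) => // i; exact: ltW.
have at_ : a <= t.
  by rewrite /a; move: ct; case: (k) => // i /(_ i); rewrite ltnSn.
have ca n : (tau n <= a) = (n < k)%N.
  by rewrite /a; case: (k) => [|i]; [rewrite leNgt tau_gt0|exact: count_tau].
have tk : t < tau k by rewrite ltNge ct ltnn.
have [Yt _] := segment a0 (le_lt_trans at_ tk) ca (scount_tau k).
rewrite (Yt t at_ tk) Ya; have [t_eq0|t_neq0] := eqVneq t 0.
  have a_eq0 : a = 0 by apply/eqP; rewrite eq_le a0 andbT -t_eq0.
  by rewrite a_eq0 t_eq0 I00 oppr0 expR0 mulr1.
have t_gt0 : 0 < t by rewrite lt_neqAle eq_sym t_neq0.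
by rewrite -(glue a t a0 at_ t_gt0) mulrAC.
Qed.

End segment.

(** The integrand ignores the mark, so the compensator integral projects onto time and the jump
    integral is a finite sum; what remains is the deterministic equation solved by
    [jump_volterra_product]. *)
Lemma doleans_dade_product d (Omega : measurableType d) (R : realType)
    (m : {measure set (measurableTypeR R) -> \bar R})
    (eta : probability (measurableTypeR R) R)
    (T Z : nat -> Omega -> R) (w : Omega) (psi Y : R -> R) :
  (forall t, m [set t] = 0%E) -> is_jump_times T ->
  measurable_fun [set: measurableTypeR R] psi ->
  (forall t : R, 0 < t -> m.-integrable `]0, t] (EFin \o psi)) ->
  is_doleans_dade (jump_measure T Z w) (m \x eta)%E (fun p => psi p.1) Y ->
  forall (t : R) (k : nat), 0 <= t -> (forall n, (T n w <= t) = (n < k)%N) ->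
  Y t = expR (- \int[m]_(s in `]0, t]) psi s) * \prod_(n < k) (1 + psi (T n w)).
Proof.
move=> atomless /(_ w)[T0 Tinc Tcvg] mpsi ipsi [cY YE] t k.
have T_gt0 n : 0 < T n w.
  by elim: n => // n IH; exact: lt_trans (Tinc n).
apply: (@jump_volterra_product R m atomless (fun n => T n w)) => // {t k} t k t0 ct.
have mH : measurable_fun (`]0, t] : set (measurableTypeR R))
    (fun s => left_limit Y s * psi s).
  apply: measurable_funM; last exact: measurable_funS mpsi.
  apply: measurable_funS (left_limit_measurable cY) => //.
  by move=> s /=; rewrite !in_itv/= andbT => /andP[].
rewrite YE// /compensated_integral.
rewrite (jump_Rintegral Z T_gt0 ct (H := fun p => left_limit Y p.1 * psi p.1)); last first.
  apply: (@measurable_comp _ _ _ _ _ _ (`]0, t] : set (measurableTypeR R))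
    (fun s : measurableTypeR R => left_limit Y s * psi s)) => //.
    by move=> _ [p [p1 _] <-].
  by apply: measurable_funTS; exact: measurable_fst.
have mI : measurable (`]0, t]%classic : set (measurableTypeR R)) by [].
have /= E := Rintegral_fst m eta mI mH.
by rewrite addrA; congr (_ - _); rewrite -E.
Qed.

(** * Exponential moments of Poisson counts *)

Lemma nneseries_single {R : realType} (f : nat -> \bar R) (n : nat) :
  (forall k, 0 <= f k)%E -> (forall k, k != n -> f k = 0%E) ->
  (\sum_(k <oo) f k = f n)%E.
Proof.
move=> f0 fn; rewrite (@nneseriesD1 _ _ n)// eseries0 ?adde0// => k _ kn.
exact: fn.
Qed.

Lemma ge0_nneseriesZl {R : realType} (x : \bar R) (f : nat -> \bar R) :
  (0 <= x)%E -> (forall k, 0 <= f k)%E ->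
  (\sum_(k <oo) x * f k = x * \sum_(k <oo) f k)%E.
Proof.
move=> x0 f0; rewrite -(ge0_integral_count (a := fun k => x * f k)%E); last by move=> k; exact: mule_ge0.
by rewrite -(ge0_integral_count f0) ge0_integralZl.
Qed.

Section product_law.
Context d (Omega : measurableType d) (R : realType) (P : probability Omega R).

Lemma measurable_nat_preimage (X : Omega -> nat) :
  (forall k, measurable [set w | X w = k]) -> measurable_fun [set: Omega] X.
Proof.
move=> mX _ B _; rewrite setTI.
have -> : X @^-1` B = \bigcup_(k in B) [set w | X w = k].
  by apply/seteqP; split => [w Bw|w [k Bk /= ->]//]; exists (X w).
exact: bigcup_measurable.
Qed.

(* Induction on the number j of coordinates with an arbitrary weight f i, the
   other weights being indicators of points. *)
Lemma expectation_prod_of_joint_law (m : nat) (X : 'I_m -> Omega -> nat)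
    (q : 'I_m -> nat -> \bar R) (f : 'I_m -> nat -> R) :
  (forall i k, measurable [set w | X i w = k]) ->
  (forall i k, 0 <= q i k)%E ->
  (forall k : 'I_m -> nat,
    P [set w | forall i, X i w = k i] = \prod_(i < m) q i (k i))%E ->
  (forall i k, 0 <= f i k) ->
  (\int[P]_w (\prod_(i < m) f i (X i w))%:E =
   \prod_(i < m) \sum_(l <oo) (f i l)%:E * q i l)%E.
Proof.
move=> mX q0 law.
have mfX (g : nat -> R) i : measurable_fun [set: Omega] (fun w => g (X i w)).
  apply: (@measurableT_comp _ _ _ _ _ _ g) => //.
  exact: measurable_nat_preimage.
suff H j : (j <= m)%N -> forall f : 'I_m -> nat -> R, (forall i k, 0 <= f i k) ->
    (forall i : 'I_m, (j <= i)%N -> exists k, forall l, f i l = (l == k)%:R) ->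
    (\int[P]_w (\prod_(i < m) f i (X i w))%:E =
     \prod_(i < m) \sum_(l <oo) (f i l)%:E * q i l)%E.
  move=> f0; apply: (H m) => // i; by rewrite leqNgt ltn_ord.
elim: j => [_ {}f _ fk|j IH jm {}f f0 fk].
  have /choice[k {}fk] : forall i : 'I_m, exists k : nat, forall l, f i l = (l == k)%:R.
    by move=> i; exact: fk.
  have -> : (fun w => (\prod_(i < m) f i (X i w))%:E) =
      (fun w => (\1_[set w | forall i, X i w = k i] w)%:E :> \bar R).
    apply/funext => w; congr EFin; rewrite indicE.
    have [/set_mem /= wk|/negP nwk] := boolP (w \in _).
      by rewrite big1// => i _; rewrite fk wk eqxx.
    have [i /eqP Xk] : exists i, X i w <> k i.
      by apply/existsNP => h; apply: nwk; rewrite inE.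
    by rewrite (bigD1 i)//= fk (negbTE Xk) mul0r.
  have mE : measurable [set w | forall i, X i w = k i].
    have -> : [set w | forall i, X i w = k i] =
        \bigcap_(i in [set: 'I_m]) [set w | X i w = k i].
      by apply/seteqP; split => w /= h i => [_|]; exact: h.
    by apply: fin_bigcap_measurable => // i _; exact: mX.
  rewrite integral_indic// setIT; apply: (eq_trans (law k)); apply: eq_bigr => i _.
  rewrite (@nneseries_single _ _ (k i)).
  - by rewrite fk eqxx mul1e.
  - by move=> l; rewrite mule_ge0// lee_fin fk.
  - by move=> l lk; rewrite fk (negbTE lk) mul0e.
pose i0 := Ordinal jm.
(* Replacing the weight of coordinate [j] by the indicator of [l] brings the product within reach of
   the induction hypothesis. *)
pose fl (l : nat) (i : 'I_m) := if i == i0 then (fun k => (k == l)%:R) else f i.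
have fl0 l i k : 0 <= fl l i k by rewrite /fl; case: ifP.
have flE l : (\int[P]_w (\prod_(i < m) fl l i (X i w))%:E =
     q i0 l * \prod_(i < m | i != i0) \sum_(l <oo) (f i l)%:E * q i l)%E.
  rewrite IH ?(ltnW jm)//.
    rewrite (bigD1 i0)//=; congr (_ * _)%E.
      rewrite /fl eqxx (@nneseries_single _ _ l).
      - by rewrite eqxx mul1e.
      - by move=> k; rewrite mule_ge0// lee_fin.
      - by move=> k kl; rewrite (negbTE kl) mul0e.
    by apply: eq_bigr => i /negbTE ii0; rewrite /fl ii0.
  move=> i ji; rewrite /fl; case: eqVneq => [_|ii0]; first by exists l.
  apply: fk; rewrite ltn_neqAle ji andbT.
  by apply: contra ii0 => /eqP ji0; apply/eqP/val_inj.
(* The weight at [i0] is expanded over the possible values [l] of [X i0]; for each [w] a single term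
   survives. *)
transitivity (\int[P]_w \sum_(l <oo) ((f i0 l) * \prod_(i < m) fl l i (X i w))%:E)%E.
  apply: eq_integral => w _; rewrite (@nneseries_single _ _ (X i0 w)).
  - congr EFin; rewrite (bigD1 i0)//= [in RHS](bigD1 i0)//= /fl !eqxx mul1r.
    by congr (_ * _); apply: eq_bigr => i /negbTE ->.
  - by move=> k; rewrite lee_fin mulr_ge0// prodr_ge0.
  - move=> k kX; rewrite (bigD1 i0)//= /fl eqxx eq_sym (negbTE kX).
    by rewrite mul0r mulr0.
have mprod l : measurable_fun [set: Omega] (fun w => \prod_(i < m) fl l i (X i w)).
  by apply: measurable_prod => i _; exact: mfX.
rewrite integral_nneseries//; last 2 first.
- move=> l; apply/measurable_EFinP; exact: measurable_funM.
- by move=> l w _; rewrite lee_fin mulr_ge0// prodr_ge0.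
rewrite (bigD1 i0)//=; set Q := (\prod_(i < m | _) _)%E.
have Q0 : (0 <= Q)%E.
  apply: prode_ge0 => i _; apply: nneseries_ge0 => l _ _.
  by rewrite mule_ge0// lee_fin.
rewrite muleC -ge0_nneseriesZl//; last by move=> l; rewrite mule_ge0// lee_fin.
apply: eq_eseriesr => l _.
under eq_integral do rewrite EFinM.
rewrite ge0_integralZl//; last 3 first.
- exact/measurable_EFinP.
- by move=> w _; rewrite lee_fin prodr_ge0.
- by rewrite lee_fin.
by rewrite flE muleA muleC.
Qed.

End product_law.

(** Exponential tilting: [exp (c l)] times the Poisson mass of parameter [r] at [l] is
    [exp ((exp c - 1) r)] times the mass of parameter [r exp c], and these masses sum to 1. At
    [r = 0] both laws are the Dirac mass at 0. *)
Lemma poisson_prob_exponential_moment {R : realType} (r c : R) : 0 <= r ->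
  (\sum_(l <oo) (expR (c * l%:R))%:E * poisson_prob r 0 [set l] =
   (expR ((expR c - 1) * r))%:E)%E.
Proof.
move=> r0.
have tilt l : ((expR (c * l%:R))%:E * poisson_prob r 0 [set l] =
    (expR ((expR c - 1) * r))%:E * poisson_prob (r * expR c) 0 [set l])%E.
  rewrite /poisson_prob pmulr_lgt0 ?expR_gt0//; case: ltgtP r0 => // [r_gt0 _|<- _].
    rewrite !esum_set1 ?lee_fin ?poisson_pmf_ge0//.
    rewrite /poisson_pmf pmulr_lgt0 ?expR_gt0// r_gt0 -!EFinM; congr EFin.
    rewrite exprMn mulrBl mul1r expRD !expRN expRM_natr ?mulrA.
    rewrite (_ : r * expR c = expR c * r); last exact: mulrC.
    have h := expR_gt0 (expR c * r).
    field; rewrite !gt_eqF// ?expR_gt0// ltr0n fact_gt0//.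
  rewrite mulr0 expR0 mul1e !diracE.
  have [->|l0] := eqVneq l 0%N; first by rewrite mulr0 expR0 mul1e.
  by rewrite memNset ?mule0//= => l0'; rewrite l0' eqxx in l0.
rewrite (eq_eseriesr (fun l _ => tilt l)) nneseriesZl//.
have -> : (\sum_(l <oo) poisson_prob (r * expR c) 0 [set l] = 1)%E; last by rewrite mule1.
rewrite -(probability_setT (poisson_prob (r * expR c) 0)).
have -> : [set: nat] = \bigcup_l [set l].
  by apply/seteqP; split => // l _; exists l.
rewrite measure_bigcup//=.
  by apply: eq_eseriesl => l; rewrite in_setT.
by apply/trivIsetP => i j _ _ ij; apply/seteqP; split => // l /= [-> /eqP]; rewrite (negbTE ij).
Qed.

Lemma poisson_prob_gt0 {R : realType} (r : R) (k : nat) : 0 < r -> (0 < poisson_prob r 0 [set k])%E.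
Proof.
move=> r0; rewrite /poisson_prob r0 esum_set1 ?lee_fin ?poisson_pmf_ge0//.
by rewrite lte_fin /poisson_pmf r0 !mulr_gt0// ?expR_gt0 ?exprn_gt0// invr_gt0 ltr0n fact_gt0.
Qed.

Lemma poisson_prob0 {R : realType} : poisson_prob (0 : R) 0 [set 0%N] = 1%E.
Proof. by rewrite /poisson_prob ltxx diracE mem_set. Qed.

Lemma jump_times_gt0 {R : realType} d (Omega : measurableType d)
    (T : nat -> Omega -> R) w n : is_jump_times T -> 0 < T n w.
Proof.
move=> /(_ w)[T0 Tinc _].
by elim: n => // n IH; exact: lt_trans (Tinc n).
Qed.

Lemma jump_count_fun {R : realType} d (Omega : measurableType d)
    (T : nat -> Omega -> R) (t : R) : is_jump_times T ->
  exists N : Omega -> nat, forall w n, (T n w <= t) = (n < N w)%N.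
Proof.
move=> jT.
have /choice[N NE] : forall w, exists k : nat, forall n, (T n w <= t) = (n < k)%N.
  by move=> w; have [_ Tinc Tcvg] := jT w; exact: (@jump_count_exists _ (fun n => T n w)).
by exists N.
Qed.

Section laplace.
Context d (Omega : measurableType d) (R : realType) (P : probability Omega R).
Local Notation RE := (measurableTypeR R * measurableTypeR R)%type.
Variables (F : R -> set (set Omega)) (nu : {measure set RE -> \bar R}).
Variables (T Z : nat -> Omega -> R).
Hypothesis filF : is_filtration F.
Hypothesis jT : is_jump_times T.
Hypothesis poi : is_poisson_process F P nu (jump_measure T Z).

Lemma filtration_setT t : 0 <= t -> F t setT.
Proof.
move=> t0; have [sF _ _] := filF; have [F0 FC _] := sF t t0.
by rewrite -(setD0 setT); exact: FC.
Qed.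

Lemma jump_count_event (t : R) (A : set RE) (k : nat) : 0 <= t -> measurable A ->
  A `<=` `]0, t] `*` setT -> F t [set w | jump_measure T Z w A = k%:R%:E].
Proof. by move=> t0 mA At; have [h _] := poi; exact: h. Qed.

Lemma jump_count_event_measurable (t : R) (A : set RE) (k : nat) : 0 <= t -> measurable A ->
  A `<=` `]0, t] `*` setT -> measurable [set w | jump_measure T Z w A = k%:R%:E].
Proof.
move=> t0 mA At; have [_ FS _] := filF.
by apply: (FS t t0); exact: jump_count_event.
Qed.

Lemma jump_count_joint_law (m : nat) (A : 'I_m -> set RE) (k : 'I_m -> nat) :
  (forall i, measurable (A i)) -> (forall i, A i `<=` `]0, +oo[ `*` setT) ->
  (forall i, nu (A i) < +oo)%E -> trivIset setT A ->
  P [set w | forall i, jump_measure T Z w (A i) = (k i)%:R%:E] =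
  (\prod_(i < m) poisson_prob (fine (nu (A i))) 0 [set k i])%E.
Proof.
move=> mA A0 nuA tA; have [_ h] := poi.
have := h 0 m A k setT (lexx 0) mA A0 nuA tA (filtration_setT (lexx 0)).
by rewrite setTI probability_setT mul1e.
Qed.

(** Laplace functional on step functions: the exponent is a combination of the counts in the
    disjoint cells, which are independent Poisson variables. *)
Lemma jump_count_exponential_moment (t : R) (m : nat) (A : 'I_m -> set RE)
    (c : 'I_m -> R) (N : Omega -> nat) : 0 <= t ->
  (forall w n, (T n w <= t) = (n < N w)%N) ->
  (forall i, measurable (A i)) -> (forall i, A i `<=` `]0, t] `*` setT) ->
  (forall i, nu (A i) < +oo)%E -> trivIset setT A ->
  (\int[P]_w (expR (\sum_(n < N w) \sum_(i < m)
      c i * \1_(A i) ((T n w, Z n w) : RE)))%:E =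
   (expR (\sum_(i < m) (expR (c i) - 1) * fine (nu (A i))))%:E)%E.
Proof.
move=> t0 NE mA At nuA tA.
pose X (i : 'I_m) (w : Omega) : nat :=
  (\sum_(n < N w) (((T n w, Z n w) : RE) \in A i))%N.
have XE i w : jump_measure T Z w (A i) = (X i w)%:R%:E.
  rewrite (jump_measureE Z (fun n => jump_times_gt0 w n jT) (NE w))//.
  by congr EFin; rewrite /X natr_sum; apply: eq_bigr => n _; rewrite indicE.
have XS i k : [set w | X i w = k] = [set w | jump_measure T Z w (A i) = k%:R%:E].
  apply/seteqP; split => w /=; rewrite XE; first by move=> ->.
  by move=> [/eqP]; rewrite eqr_nat => /eqP.
under eq_integral.
  move=> w _; rewrite (_ : expR _ = \prod_(i < m) expR (c i * (X i w)%:R)); last first.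
    rewrite exchange_big/= expR_sum; apply: eq_bigr => i _.
    rewrite -mulr_sumr; congr (expR (_ * _)).
    by rewrite /X natr_sum; apply: eq_bigr => n _; rewrite indicE.
  over.
rewrite (@expectation_prod_of_joint_law _ _ _ P m X
  (fun i l => poisson_prob (fine (nu (A i))) 0 [set l])
  (fun i l => expR (c i * l%:R))).
- rewrite expR_sum -prodEFin; apply: eq_bigr => i _.
  by apply: poisson_prob_exponential_moment; apply: fine_ge0; exact: measure_ge0.
- by move=> i k; rewrite XS; apply: (jump_count_event_measurable k t0 (mA i)); exact: At.
- by move=> i k; exact: measure_ge0.
- move=> k; rewrite -jump_count_joint_law//.
    congr (P _); apply/seteqP; split => w /= h i.
      by have := h i; rewrite XE => ->.
    by have := h i; rewrite XE => -[/eqP]; rewrite eqr_nat => /eqP.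
  move=> i p /At[/=]; rewrite !in_itv/= => /andP[-> _]; by split.
- by move=> i k; exact: expR_ge0.
Qed.

Lemma jump_count_measurable (t : R) (A : set RE) (N : Omega -> nat) : 0 <= t ->
  (forall w n, (T n w <= t) = (n < N w)%N) -> measurable A ->
  A `<=` `]0, t] `*` setT ->
  measurable_fun [set: Omega]
    (fun w => \sum_(n < N w) \1_A ((T n w, Z n w) : RE) : R).
Proof.
move=> t0 NE mA At.
pose X (w : Omega) : nat := (\sum_(n < N w) (((T n w, Z n w) : RE) \in A))%N.
have XE w : \sum_(n < N w) \1_A ((T n w, Z n w) : RE) = (X w)%:R :> R.
  by rewrite /X natr_sum; apply: eq_bigr => n _; rewrite indicE.
rewrite (_ : (fun w => _) = (fun k : nat => k%:R : R) \o X); last first.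
  by apply/funext => w; exact: XE.
apply: measurableT_comp => //; apply: measurable_nat_preimage => k.
have -> : [set w | X w = k] = [set w | jump_measure T Z w A = k%:R%:E].
  apply/seteqP; split => w /=;
    rewrite (jump_measureE Z (fun n => jump_times_gt0 w n jT) (NE w) At) XE.
    by move=> ->.
  by move=> [/eqP]; rewrite eqr_nat => /eqP.
exact: (jump_count_event_measurable k t0 mA At).
Qed.

(** Step functions below [f] satisfy the bound by the exact formula, and Fatou passes it to the
    limit. Measurability comes along, as a pointwise limit of functions of counts. *)
Lemma jump_exponential_moment_le (t : R) (f : RE -> R) (I : R) (N : Omega -> nat) :
  0 <= t -> (forall w n, (T n w <= t) = (n < N w)%N) ->
  measurable_fun [set: RE] f -> (forall p, 0 <= f p) ->
  (forall p, ~ (`]0, t] `*` setT) p -> f p = 0) ->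
  (\int[nu]_p (expR (f p) - 1)%:E <= I%:E)%E ->
  measurable_fun [set: Omega] (fun w => expR (\sum_(n < N w) f (T n w, Z n w))) /\
  (\int[P]_w (expR (\sum_(n < N w) f (T n w, Z n w)))%:E <= (expR I)%:E)%E.
Proof.
move=> t0 NE mf f0 fout intI.
(* Level sets of [f] on a grid of mesh [1 / (n + 1)]. The grid starts at [1 / (n + 1)] rather than
   0, which keeps the cells inside the strip and of finite intensity; [(n + 1)^2] cells reach above
   level [n]. *)
pose A (n : nat) (i : 'I_(n.+1 * n.+1)) : set RE :=
  f @^-1` `[i.+1%:R / n.+1%:R, i.+2%:R / n.+1%:R[.
pose c (n : nat) (i : 'I_(n.+1 * n.+1)) : R := i.+1%:R / n.+1%:R.
have n0 n : 0 < n.+1%:R :> R by rewrite ltr0n.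
have AE n i p : A n i p <-> Num.truncn (f p * n.+1%:R) = i.+1.
  rewrite /A /= in_itv/= ler_pdivrMr// ltr_pdivlMr//.
  rewrite -truncn_eq ?mulr_ge0// ?ltW//; exact: iff_sym (rwP eqP).
have mA n i : measurable (A n i).
  by rewrite -[A n i]setTI; apply: mf => //; exact: measurable_itv.
have c_gt0 n i : 0 < c n i by rewrite divr_gt0// ltr0n.
have At n i : A n i `<=` `]0, t] `*` setT.
  move=> p; rewrite /A /= in_itv/= => /andP[cf _]; apply: contrapT => /fout fp.
  by have := lt_le_trans (c_gt0 n i) cf; rewrite fp ltxx.
have tA n : trivIset setT (A n).
  apply/trivIsetP => i j _ _ ij; apply/seteqP; split => // p [/AE pi /AE pj].
  by move: ij; rewrite -val_eqE -eqSS -pi pj eqxx.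
have sumA n (g : 'I_(n.+1 * n.+1) -> R) p :
    (exists i, A n i p /\ \sum_i g i * \1_(A n i) p = g i) \/
    ((forall i, ~ A n i p) /\ \sum_i g i * \1_(A n i) p = 0).
  have [[i Aip]|/forallNP nA] := pselect (exists i, A n i p).
    left; exists i; split => //; rewrite (bigD1 i)//= indicE mem_set// mulr1.
    rewrite big1 ?addr0// => j ji; rewrite indicE memNset ?mulr0// => Ajp.
    have /trivIsetP/(_ j i Logic.I Logic.I ji)/seteqP[/(_ p) h _] := tA n.
    by case: (h (conj Ajp Aip)).
  right; split => //; rewrite big1// => i _.
  by rewrite indicE memNset ?mulr0//; exact: nA.
pose fn n p := \sum_i c n i * \1_(A n i) p.
have fn_le n p : fn n p <= f p.
  rewrite /fn; have [[i [Ai ->]]|[_ ->]] := sumA n (c n) p; last exact: f0.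
  by move: Ai; rewrite /A /= in_itv/= => /andP[].
have fn_ge n p : f p < n%:R -> f p - n.+1%:R^-1 <= fn n p.
  move=> pn.
  rewrite /fn; have [[i [Ai ->]]|[nA ->]] := sumA n (c n) p.
    move: Ai; rewrite /A /= in_itv/= => /andP[_ /ltW fi].
    by rewrite lerBlDr (le_trans fi)// /c -[i.+2%:R]natr1 mulrDl mul1r.
  rewrite subr_le0 -(mul1r n.+1%:R^-1) ler_pdivlMr//.
  have fge0 : 0 <= f p * n.+1%:R by rewrite mulr_ge0// ltW.
  have trlt : (Num.truncn (f p * n.+1%:R) <= n.+1 * n.+1)%N.
    rewrite ltnW// truncn_lt_nat// natrM ltr_pM2r//.
    by rewrite (lt_trans pn)// ltr_nat.
  case E : (Num.truncn (f p * n.+1%:R)) => [|k].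
    by have := truncnS_gt (f p * n.+1%:R); rewrite E => /ltW.
  have kK : (k < n.+1 * n.+1)%N by rewrite -E.
  by case: (nA (Ordinal kK)); apply/AE.
have fn_cvg p : fn n p @[n --> \oo] --> f p.
  apply: (@squeeze_cvgr _ _ _ _ (fun n => f p - n.+1%:R^-1) (cst (f p))).
  - near=> n; rewrite fn_le andbT; apply: fn_ge.
    by near: n; exact: nbhs_infty_gtr.
  - rewrite -[X in _ --> X]subr0; apply: cvgB; first exact: cvg_cst.
    exact: cvg_harmonic.
  - exact: cvg_cst.
have e1_ge0 n i : 0 <= expR (c n i) - 1.
  by rewrite subr_ge0 -expR0 ler_expR ltW.
have int_sum n : (\sum_i (expR (c n i) - 1)%:E * nu (A n i) <= I%:E)%E.
  apply: le_trans intI.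
  have -> : (\sum_i (expR (c n i) - 1)%:E * nu (A n i) =
     \int[nu]_p (\sum_i (expR (c n i) - 1) * \1_(A n i) p)%:E)%E.
    under eq_integral do rewrite -sumEFin.
    rewrite ge0_integral_sum//.
    - apply: eq_bigr => i _; under eq_integral do rewrite EFinM.
      rewrite ge0_integralZl//; last by rewrite lee_fin.
        by rewrite integral_indic// setIT.
      by apply/measurable_EFinP; exact: measurable_indic.
    - by move=> i; apply/measurable_EFinP; apply: measurable_funM => //; exact: measurable_indic.
    - by move=> i p _; rewrite lee_fin mulr_ge0.
  apply: ge0_le_integral => //.
  - by move=> p _; rewrite lee_fin sumr_ge0// => i _; rewrite mulr_ge0.
  - apply/measurable_EFinP; apply: measurable_sum => i.
    by apply: measurable_funM => //; exact: measurable_indic.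
  - apply/measurable_EFinP; apply: measurable_funB => //.
    by apply: measurableT_comp mf; exact: measurable_expR.
  - move=> p _; rewrite lee_fin.
    have [[i [Ai ->]]|[_ ->]] := sumA n (fun i => expR (c n i) - 1) p.
      rewrite lerD2r ler_expR.
      by move: Ai; rewrite /A /= in_itv/= => /andP[].
    by rewrite subr_ge0 -expR0 ler_expR.
(* Chebyshev: the weight [expR (c n i) - 1] is positive and the weighted sum of intensities is at
   most [I]. *)
have nuA n i : (nu (A n i) < +oo)%E.
  have h : ((expR (c n i) - 1)%:E * nu (A n i) <= I%:E)%E.
    apply: le_trans (int_sum n); rewrite (bigD1 i)//= leeDl//.
    by apply: sume_ge0 => j _; rewrite mule_ge0// lee_fin.
  rewrite ltey; apply/eqP => nuoo; move: h; rewrite nuoo.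
  by rewrite gt0_muley ?lte_fin ?subr_gt0 -?expR0 ?ltr_expR// leye_eq.
pose h n w := expR (\sum_(k < N w) fn n ((T k w, Z k w) : RE)).
have hI n : (\int[P]_w (h n w)%:E <= (expR I)%:E)%E.
  rewrite /h /fn (@jump_count_exponential_moment t _ (A n) (c n) N)//.
  rewrite lee_fin ler_expR -lee_fin -sumEFin; apply: le_trans (int_sum n).
  apply: lee_sum => i _; rewrite EFinM fineK// ge0_fin_numE//; exact: nuA.
have mh n : measurable_fun [set: Omega] (h n).
  apply: measurableT_comp; first exact: measurable_expR.
  rewrite (_ : (fun w => _) = (fun w => \sum_i c n i *
      \sum_(k < N w) \1_(A n i) ((T k w, Z k w) : RE))); last first.
    apply/funext => w; rewrite /fn exchange_big/=; apply: eq_bigr => i _.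
    by rewrite mulr_sumr.
  apply: measurable_sum => i; apply: measurable_funM => //.
  exact: (jump_count_measurable t0 NE (mA n i) (At n i)).
have h_cvg w : h n w @[n --> \oo] --> expR (\sum_(k < N w) f (T k w, Z k w)).
  apply: continuous_cvg; first exact: continuous_expR.
  by apply: cvg_big => [|k _]; [exact: add_continuous|exact: fn_cvg].
split; first exact: (measurable_fun_cvg mh (fun w _ => h_cvg w)).
pose g n w := (h n w)%:E : \bar R.
have gI n : (\int[P]_w g n w <= (expR I)%:E)%E by exact: hI.
have mg n : measurable_fun [set: Omega] (g n) by exact/measurable_EFinP.
have g_cvg w : g n w @[n --> \oo] --> (expR (\sum_(k < N w) f (T k w, Z k w)))%:E.
  by apply: cvg_EFin; [near=> n|exact: h_cvg].
have := fatou P (measurableT : measurable [set: Omega]) mg (fun n x _ => expR_ge0 _).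
rewrite (eq_integral (fun w => (expR (\sum_(k < N w) f (T k w, Z k w)))%:E)); last first.
  by move=> w _; have [-> _] := cvg_limn_einf_sup (g_cvg w).
move=> /le_trans; apply.
rewrite limn_einf_lim; apply: lime_le; first exact: is_cvg_einfs.
near=> n; apply: le_trans (gI n).
by apply: ereal_inf_lbound; exists n => //=.
Unshelve. all: by end_near. Qed.

End laplace.

(** * A maximal inequality for likelihood ratios *)

Section filtration_events.
Context d (Omega : measurableType d) (R : realType).
Variable F : R -> set (set Omega).
Hypothesis filF : is_filtration F.

Lemma filtrationC t A : 0 <= t -> F t A -> F t (~` A).
Proof.
move=> t0 FA; have [sF _ _] := filF; have [_ FC _] := sF t t0.
by rewrite -setTD; exact: FC.
Qed.

Lemma filtrationU t A B : 0 <= t -> F t A -> F t B -> F t (A `|` B).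
Proof.
move=> t0 FA FB; have [sF _ _] := filF; have [F0 _ FU] := sF t t0.
by rewrite -bigcup2E; apply: FU => -[|[|n]].
Qed.

Lemma filtrationI t A B : 0 <= t -> F t A -> F t B -> F t (A `&` B).
Proof.
move=> t0 FA FB; rewrite -(setCK (A `&` B)) setCI.
by apply: filtrationC => //; apply: filtrationU => //; exact: filtrationC.
Qed.

Lemma filtration_measurable t A : 0 <= t -> F t A -> measurable A.
Proof. by move=> t0; have [_ FS _] := filF; exact: FS. Qed.

Lemma filtration_le s t A : 0 <= s -> s <= t -> F s A -> F t A.
Proof. by move=> s0 st; have [_ _ FM] := filF; exact: FM. Qed.

End filtration_events.

(** [G] is made the measurable structure of a type of its own, so that the measurability of
    comparisons applies relative to [G] instead of the ambient sigma-algebra. *)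
Lemma sigma_algebra_le_set d (Omega : measurableType d) (R : realType)
    (G : set (set Omega)) (a b : Omega -> R) : sigma_algebra [set: Omega] G ->
  (forall B : set (measurableTypeR R), measurable B -> G (a @^-1` B)) ->
  (forall B : set (measurableTypeR R), measurable B -> G (b @^-1` B)) ->
  G [set w | a w <= b w].
Proof.
move=> sG Ga Gb.
have GE : <<s G >> = G by exact: sigma_algebra_id.
have mG (f : Omega -> R) :
    (forall B : set (measurableTypeR R), measurable B -> G (f @^-1` B)) ->
    measurable_fun [set: g_sigma_algebraType G] (f : g_sigma_algebraType G -> R).
  by move=> Gf _ B mB; rewrite setTI /measurable/= GE; exact: Gf.
have := measurable_fun_le measurableT (mG _ Ga) (mG _ Gb).
by rewrite setTI /measurable/= GE.
Qed.

Section ratio_maximal.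
Context d (Omega : measurableType d) (R : realType).
Variables (P Q1 Q2 : probability Omega R) (F : R -> set (set Omega)).
Variables (L1 L2 : R -> Omega -> R).
Hypothesis filF : is_filtration F.
Hypothesis dens1 : forall t, 0 <= t -> is_density_on (F t) P Q1 (L1 t).
Hypothesis dens2 : forall t, 0 <= t -> is_density_on (F t) P Q2 (L2 t).

Let hit (t : R) : set Omega := [set w | L1 t w <= 2 * L2 t w].

Lemma hit_event (t : R) : 0 <= t -> F t (hit t).
Proof.
move=> t0; have [sF _ _] := filF.
have [m1 _ _] := dens1 t0; have [m2 _ _] := dens2 t0.
apply: sigma_algebra_le_set (sF t t0) m1 _ => B mB.
rewrite (_ : _ @^-1` B = L2 t @^-1` ((fun x : R => 2 * x) @^-1` B))//.
apply: m2; rewrite -[X in measurable X]setTI.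
by apply: (measurable_funM (measurable_cst (2 : R)) (@measurable_id _ (measurableTypeR R) setT)).
Qed.

Lemma hit_le (t : R) B : 0 <= t -> F t B -> (Q1 (B `&` hit t) <= 2%:E * Q2 (B `&` hit t))%E.
Proof.
move=> t0 FB.
have FBt : F t (B `&` hit t) by apply: (filtrationI filF) => //; exact: hit_event.
have mBt : measurable (B `&` hit t) by exact: (filtration_measurable filF t0).
have [m1 i1 d1] := dens1 t0; have [m2 i2 d2] := dens2 t0.
have i1' := integrableS measurableT mBt (@subsetT _ _) i1.
have i2' := integrableS measurableT mBt (@subsetT _ _) i2.
rewrite d1// d2// -integralZl//.
apply: le_integral => //; first exact: (integrableZl mBt 2 i2').
by move=> w /[!inE] -[_]; rewrite -EFinM lee_fin.
Qed.

Let hits (l : seq R) : set Omega := [set w | exists2 t, t \in l & L1 t w <= 2 * L2 t w].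

Let hits_measurable l : (forall t, t \in l -> 0 <= t) -> measurable (hits l).
Proof.
elim: l => [_|t l IH l0].
  by rewrite (_ : hits _ = set0)//; apply/seteqP; split => // w [].
rewrite (_ : hits _ = hit t `|` hits l).
  apply: measurableU; last by apply: IH => u ul; apply: l0; rewrite inE ul orbT.
  apply: (filtration_measurable filF (l0 t _)); rewrite ?mem_head//.
  by apply: hit_event; apply: l0; exact: mem_head.
apply/seteqP; split => w.
  by move=> [u]; rewrite inE => /predU1P[->|ul] h; [left|right; exists u].
by move=> [h|[u ul h]]; [exists t => //; exact: mem_head|exists u => //; rewrite inE ul orbT].
Qed.

(* Decompose according to the first time of l at which L1 <= 2 L2. *)
Lemma ratio_maximal_seq (s : R) (l : seq R) B : 0 <= s -> path <=%R s l -> F s B ->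
  (Q1 (B `&` hits l) <= 2%:E * Q2 B)%E.
Proof.
elim: l s B => [|t l IH] s B s0 /=.
  move=> _ FB; rewrite (_ : hits _ = set0) ?setI0 ?measure0 ?mule_ge0//.
  by apply/seteqP; split => // w [].
move=> /andP[st pl] FsB.
have t0 : 0 <= t by exact: le_trans st.
have FB : F t B by exact: (filtration_le filF s0 st).
have l0 u : u \in l -> 0 <= u.
  move=> ul; apply: (le_trans t0).
  by have := order_path_min le_trans pl => /allP; exact.
have FBh : F t (B `&` hit t) by apply: (filtrationI filF) => //; exact: hit_event.
have FBn : F t (B `&` ~` hit t).
  apply: (filtrationI filF) => //; apply: (filtrationC filF) => //; exact: hit_event.
have mBh : measurable (B `&` hit t) by exact: (filtration_measurable filF t0).
have mBn : measurable (B `&` ~` hit t) by exact: (filtration_measurable filF t0).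
have mH : measurable (hits l) by exact: hits_measurable.
have sub : B `&` hits (t :: l) `<=` (B `&` hit t) `|` ((B `&` ~` hit t) `&` hits l).
  move=> w [Bw [u]]; rewrite inE => /predU1P[->|ul] h; first by left.
  have [ht|ht] := pselect (hit t w); first by left.
  by right; split => //; exists u.
apply: (@le_trans _ _ (Q1 (B `&` hit t) + Q1 ((B `&` ~` hit t) `&` hits l)))%E.
  apply: le_trans (measureU2 Q1 mBh (measurableI _ _ mBn mH)).
  apply: le_measure => //; rewrite inE.
    apply: measurableI; first exact: (filtration_measurable filF t0).
    by apply: hits_measurable => u; rewrite inE => /predU1P[->//|]; exact: l0.
  by apply: measurableU => //; exact: measurableI.
(* Where [t] is hit the densities compare directly; the remainder of [B] belongs to [F t], so the
   induction restarts from time [t] on it. The two pieces are disjoint and their costs add up. *)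
apply: (@le_trans _ _ (2%:E * Q2 (B `&` hit t) + 2%:E * Q2 (B `&` ~` hit t)))%E.
  by apply: leeD; [exact: hit_le|exact: IH pl FBn].
rewrite -ge0_muleDr ?measure_ge0// -measureU//.
  by rewrite -setIUr setUv setIT.
by rewrite setIACA setICr setI0.
Qed.

(** Countably many times keep the event measurable, and continuity from below passes the bound from
    finite lists, sorted for [ratio_maximal_seq], to all rationals. Right-continuity of the paths
    recovers real times later. *)
Lemma ratio_maximal_rat (s : R) B : 0 <= s -> F s B ->
  let E := B `&` [set w | exists2 r : rat, s <= ratr r & L1 (ratr r) w <= 2 * L2 (ratr r) w] in
  measurable E /\ (Q1 E <= 2%:E * Q2 B)%E.
Proof.
move=> s0 FB E.
pose l (n : nat) := [seq x <- [seq ratr (odflt 0 (unpickle i)) | i <- iota 0 n] | s <= x] : seq R.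
have ls n x : x \in l n -> s <= x by rewrite mem_filter => /andP[].
have l0 n x : x \in l n -> 0 <= x by move=> /ls; exact: le_trans.
have mB : measurable B by exact: (filtration_measurable filF s0).
pose En n := B `&` hits (l n).
have mEn n : measurable (En n) by apply: measurableI => //; exact: hits_measurable (@l0 n).
have EE : E = \bigcup_n En n.
  apply/seteqP; split => w.
    move=> [Bw [r sr h]]; exists (pickle r).+1 => //; split => //.
    exists (ratr r) => //; rewrite mem_filter sr andTb; apply/mapP; exists (pickle r).
      by rewrite mem_iota/= add0n.
    by rewrite pickleK.
  move=> [n _ [Bw [t]]]; rewrite mem_filter => /andP[st /mapP[i _ tE]] h.
  by split => //; exists (odflt 0 (unpickle i)); rewrite -tE.
have ndE : nondecreasing_seq En.
  move=> i j ij; apply/subsetPset; apply: setIS => w [t]; rewrite mem_filter.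
  move=> /andP[st /mapP[k ki tE]] h; exists t => //; rewrite mem_filter st/=.
  apply/mapP; exists k => //; move: ki; rewrite !mem_iota/= !add0n => ki.
  exact: leq_trans ki ij.
have mE : measurable E by rewrite EE; exact: bigcupT_measurable.
split=> //; have := nondecreasing_cvg_mu (mu := Q1) mEn.
rewrite -EE => /(_ mE ndE) Ecvg.
apply: (cvge_to_le Ecvg); near=> n => /=.
apply: le_trans (@ratio_maximal_seq s (sort <=%R (l n)) B s0 _ FB).
  rewrite le_eqVlt; apply/orP; left; apply/eqP; congr (Q1 (_ `&` _)).
  by apply/seteqP; split => w [t tl h]; exists t => //; move: tl; rewrite mem_sort.
rewrite path_min_sorted ?sort_sorted//; first exact: le_total.
by apply/allP => x; rewrite mem_sort; exact: ls.
Unshelve. all: by end_near. Qed.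

End ratio_maximal.

(** * Separation of the likelihoods *)

(* AM-GM: the geometric mean y of 1 + v x and 1 + th x satisfies
   2 y M <= y^2 + M^2 with M their arithmetic mean. *)
Lemma geometric_mean_le {R : realFieldType} (v th x y : R) : 0 <= v -> 0 <= th -> 0 <= x ->
  y ^+ 2 = (1 + v * x) * (1 + th * x) ->
  y <= 1 + (v + th) / 2 * x -
       (v - th) ^+ 2 / 8 * (x ^+ 2 - (v + th) / 2 * x ^+ 3).
Proof.
move=> v0 th0 x0 y2; set M := 1 + (v + th) / 2 * x.
have M1 : 1 <= M by rewrite lerDl mulr_ge0// divr_ge0// addr_ge0.
have M0 : 0 < M by exact: lt_le_trans M1.
have yM : 2 * y * M <= y ^+ 2 + M ^+ 2 by have := sqr_ge0 (y - M); nra.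
(* [2 c x^2] is the gap [M^2 - y^2]. Dividing AM-GM by [2 M] gives [y <= M - c x^2 / M], and
   [1 / M >= 2 - M] produces the cubic term. *)
set c := (v - th) ^+ 2 / 8.
have c0 : 0 <= c by rewrite divr_ge0// sqr_ge0.
have y2E : y ^+ 2 = M ^+ 2 - 2 * c * x ^+ 2.
  by rewrite y2 /M /c; field.
have -> : c * (x ^+ 2 - (v + th) / 2 * x ^+ 3) = c * x ^+ 2 * (2 - M).
  by rewrite /M; ring.
have cx : 0 <= c * x ^+ 2 by rewrite mulr_ge0// sqr_ge0.
rewrite -(ler_pM2r M0).
have h : (2 - M) * M <= 1 by have := sqr_ge0 (M - 1); nra.
have : c * x ^+ 2 * ((2 - M) * M) <= c * x ^+ 2 by rewrite ler_piMr.
by move: yM; rewrite y2E; nra.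
Qed.

Section model.
Context d (Omega : measurableType d) (R : realType) (P : probability Omega R).
Local Notation RE := (measurableTypeR R * measurableTypeR R)%type.
Variables (F : R -> set (set Omega)) (m : {measure set (measurableTypeR R) -> \bar R}).
Variables (eta : probability (measurableTypeR R) R) (T Z : nat -> Omega -> R).
Variables (phi : R -> R) (L : R -> R -> Omega -> R) (Pr : R -> probability Omega R).
Hypothesis atomless : forall t, m [set t] = 0%E.
Hypothesis filF : is_filtration F.
Hypothesis jT : is_jump_times T.
Hypothesis poi : is_poisson_process F P (m \x eta)%E (jump_measure T Z).
Hypothesis mphi : measurable_fun [set: measurableTypeR R] phi.
Hypothesis iphi : forall t : R, 0 < t -> m.-integrable `]0, t] (EFin \o phi).
Hypothesis dd : forall v w, 0 <= v ->
  is_doleans_dade (jump_measure T Z w) (m \x eta)%E (fun p => v * phi p.1)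
    (fun t => L v t w).
Hypothesis dens : forall v t, 0 <= v -> 0 <= t -> is_density_on (F t) P (Pr v) (L v t).

Lemma likelihood_product v t w k : 0 <= v -> 0 <= t ->
  (forall n, (T n w <= t) = (n < k)%N) ->
  L v t w = expR (- (v * \int[m]_(s in `]0, t]) phi s)) *
            \prod_(n < k) (1 + v * phi (T n w)).
Proof.
move=> v0; rewrite le_eqVlt => /predU1P[<-|t0] ct.
  rewrite (@doleans_dade_product _ _ _ m eta T Z w (fun s => v * phi s)
    (fun t => L v t w) atomless jT _ _ (dd w v0) 0 k)//.
  - by rewrite set_itv_ge ?bnd_simp ?ltxx// !Rintegral_set0 mulr0.
  - exact: measurable_funM.
  - by move=> s s0; apply: (integrableZl _ v (iphi s0)).
rewrite (@doleans_dade_product _ _ _ m eta T Z w (fun s => v * phi s)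
    (fun t => L v t w) atomless jT _ _ (dd w v0) t k)//.
- by rewrite RintegralZl//; exact: iphi.
- exact: measurable_funM.
- by move=> s s0; apply: (integrableZl _ v (iphi s0)).
- exact: ltW.
Qed.

(* If phi < -1/v on a set B of positive intensity, then the likelihood of v is
   negative on the event that there is exactly one jump in B and none at the
   zeros of 1 + v phi; this event would have a negative probability. *)
Lemma phi_below_null (t v : R) : 0 < t -> 0 < v ->
  m (`]0, t] `&` phi @^-1` `]-oo, (- v^-1)[) = 0%E.
Proof.
move=> t0 v0.
set B := `]0, t] `&` _; pose C := `]0, t] `&` phi @^-1` [set (- v^-1)].
have mB : measurable (B : set (measurableTypeR R)).
  by apply: (measurable_funTS mphi) => //; exact: measurable_itv.
have mC : measurable (C : set (measurableTypeR R)).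
  by apply: (measurable_funTS mphi) => //; exact: measurable_set1.
(* Markov's inequality for the integrable [|phi|]: the Poisson law is available only on sets of
   finite intensity. *)
have fin (D : set (measurableTypeR R)) : measurable D -> D `<=` `]0, t] ->
    (forall s, D s -> v^-1 <= `|phi s|) -> (m D < +oo)%E.
  move=> mD Dt Dphi.
  have mphit : measurable_fun (`]0, t] : set (measurableTypeR R)) (EFin \o phi).
    by apply: (measurable_int m); exact: iphi.
  have vi : 0 < v^-1 by rewrite invr_gt0.
  have h : ((v^-1)%:E * m D <= \int[m]_(s in `]0%R, t]) `|(EFin \o phi) s|)%E.
    have := @le_integral_abse _ _ _ m `]0, t]%classic _ (EFin \o phi) v^-1 mphit vi.
    move=> /(_ (measurable_itv _)) h; apply: le_trans h; rewrite lee_pmul2l ?lte_fin//.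
    apply: le_measure; rewrite ?inE//.
      apply: emeasurable_fun_c_infty => //. by apply: measurableT_comp.
    by move=> s Ds; split; [exact: Dt|rewrite /= lee_fin; exact: Dphi].
  have /integrableP[_ foo] := iphi t0.
  have := le_lt_trans h foo; rewrite ltNge => /negP h'.
  by rewrite ltey; apply/eqP => moo; apply: h'; rewrite moo gt0_muley ?lte_fin.
have vi : 0 < v^-1 by rewrite invr_gt0.
have finB : (m B < +oo)%E.
  apply: fin => //; first exact: subIsetl.
  move=> s [_]; rewrite /= in_itv/= => sv.
  have s0 : phi s < 0 by rewrite (lt_trans sv)// oppr_lt0.
  by rewrite (ltr0_norm s0); lra.
have finC : (m C < +oo)%E.
  apply: fin => //; first exact: subIsetl.
  by move=> s [_ /= ->]; rewrite normrN ger0_norm// ltW.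
apply/eqP; rewrite eq_le measure_ge0 andbT leNgt; apply/negP => B0.
pose A (i : 'I_2) : set RE := if i == ord0 then B `*` setT else C `*` setT.
pose k (i : 'I_2) : nat := if i == ord0 then 1%N else 0%N.
have mA i : measurable (A i) by rewrite /A; case: ifP => _; exact: measurableX.
have At i : A i `<=` `]0, t] `*` setT.
  by rewrite /A; case: ifP => _ p [[pt _] _]; split.
pose G := [set w | forall i, jump_measure T Z w (A i) = (k i)%:R%:E].
have GE : G = [set w | jump_measure T Z w (A ord0) = 1%:R%:E] `&`
              [set w | jump_measure T Z w (A ord_max) = 0%:R%:E].
  apply/seteqP; split => w /=.
    by move=> h; split; [exact: (h ord0)|exact: (h ord_max)].
  move=> [h0 h1] i; have [->|i0] := eqVneq i ord0; first exact: h0.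
  suff -> : i = ord_max by exact: h1.
  by apply/val_inj; case: i i0 => -[|[|]].
have FG : F t G.
  rewrite GE; apply: (filtrationI filF (ltW t0)).
    exact: (jump_count_event poi 1 (ltW t0) (mA ord0) (At ord0)).
  exact: (jump_count_event poi 0 (ltW t0) (mA ord_max) (At ord_max)).
have PG : (0 < P G)%E.
  rewrite (jump_count_joint_law filF poi)//.
  - rewrite !big_ord_recl big_ord0 mule1 /=.
    apply: mule_gt0.
      apply: poisson_prob_gt0; rewrite strip_measure//.
      by apply: fine_gt0; rewrite B0.
    rewrite strip_measure//.
    have [->|C0] := eqVneq (fine (m C)) 0; first by rewrite poisson_prob0 lte01.
    by apply: poisson_prob_gt0; rewrite lt_neqAle eq_sym C0 fine_ge0.
  - by move=> i p /At[/=]; rewrite !in_itv/= => /andP[-> _]; split.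
  - by move=> i; rewrite /A; case: ifP => _; rewrite [X in (X < _)%E]strip_measure.
  - apply/trivIsetP => i j _ _; rewrite /A.
    have dBC : (B `*` setT) `&` (C `*` setT) = set0 :> set RE.
      apply/seteqP; split => // p [[[_ pB] _] [[_ pC] _]].
      by move: pB pC; rewrite /= in_itv/= => + pC; rewrite pC ltxx.
    case: i j => [[|[|]]//= ?] [[|[|]]//= ?]; rewrite -?val_eqE//= => _.
    by rewrite setIC.
have [mL iL densG] := dens (ltW v0) (ltW t0).
have mG : measurable G by exact: (filtration_measurable filF (ltW t0)).
have [N NE] := jump_count_fun t jT.
have Lneg w : G w -> L v t w < 0.
  rewrite GE => -[/= w0 w1].
  have T_gt0 n : 0 < T n w by exact: jump_times_gt0.
  rewrite (jump_measureE Z T_gt0 (NE w) (At _)) in w0.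
  rewrite (jump_measureE Z T_gt0 (NE w) (At _)) in w1.
  have inB n : (((T n w, Z n w) : RE) \in A ord0) = ((n < N w)%N && (1 + v * phi (T n w) < 0)).
    rewrite -NE /A /=; apply/idP/idP.
      rewrite inE => -[[/= + +] _]; rewrite !in_itv/= T_gt0/= => -> h.
      by rewrite /= -ltrBrDl sub0r -ltr_pdivlMl// mulrN1.
    move=> /andP[nt h]; rewrite inE; split => //; split; rewrite /= in_itv/= ?T_gt0//.
    by rewrite -[- _]mulrN1 ltr_pdivlMl// -subr_gt0; move: h; lra.
  have inC n : (((T n w, Z n w) : RE) \in A ord_max) = ((n < N w)%N && (1 + v * phi (T n w) == 0)).
    rewrite -NE /A /=; apply/idP/idP.
      rewrite inE => -[[/= + ->] _]; rewrite !in_itv/= T_gt0/= => ->.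
      by rewrite mulrN (divff (lt0r_neq0 v0)) subrr/= eqxx.
    move=> /andP[nt /eqP h]; rewrite inE; split => //; split; rewrite /= ?in_itv/= ?T_gt0//.
    have : phi (T n w) = (1 + v * phi (T n w) - 1) / v by field; rewrite gt_eqF.
    by rewrite h sub0r mulN1r.
  have {}w0 : (\sum_(n < N w) (1 + v * phi (T n w) < 0)%R == 1)%N.
    move: w0 => [] /eqP; under eq_bigr do rewrite indicE inB ltn_ord.
    by rewrite -natr_sum eqr_nat.
  have {}w1 n : (n < N w)%N -> 1 + v * phi (T n w) != 0.
    move=> nN; apply/negP => h; move: w1 => [] /eqP.
    rewrite gt_eqF// (bigD1 (Ordinal nN))//= indicE inC nN h.
    by rewrite ltr_wpDr// sumr_ge0// => j _; rewrite indicE.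
  have /sum_nat_eq1[i [_ iB jB]] := w0.
  rewrite (likelihood_product (ltW v0) (ltW t0) (NE w)).
  rewrite pmulr_rlt0 ?expR_gt0// (bigD1 i)//= nmulr_rlt0.
    apply: prodr_gt0 => j ji; rewrite lt_neqAle eq_sym w1//=.
    by rewrite leNgt; apply/negP => h; have := jB j ji isT; rewrite h.
  by move: iB; case: (_ < 0).
have mLv : measurable_fun [set: Omega] (L v t).
  by apply/measurable_EFinP; apply: (measurable_int P); exact: iL.
(* The integral of the negative function [L v t] over [G] is the probability [Pr v G], hence
   nonnegative; so it vanishes and [L v t] is null almost everywhere on [G], which contradicts
   [PG]. *)
have intG : (\int[P]_(w in G) `|(L v t w)%:E| = 0)%E.
  apply/eqP; rewrite eq_le integral_ge0// andbT.
  have -> : (\int[P]_(w in G) `|(L v t w)%:E| = - \int[P]_(w in G) (L v t w)%:E)%E.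
    rewrite -integralN.
      apply: eq_integral => w /[!inE] Gw.
      by rewrite lte0_abs// lte_fin Lneg.
    have iG : P.-integrable G (EFin \o L v t) by exact: (integrableS _ mG _ iL).
    exact: (integrable_add_def mG iG).
  by rewrite oppe_le0 -(densG G FG) measure_ge0.
have [|N0 [mN0 PN0 subN0]] := (ae_eq_integral_abs P mG (f := EFin \o L v t) _).1 intG.
  by apply: measurable_funTS; exact/measurable_EFinP.
have : (P G <= 0)%E.
  rewrite -PN0; apply: le_measure; rewrite ?inE//.
  move=> w Gw; apply: subN0 => /= /(_ Gw) [] L0.
  by have := Lneg w Gw; rewrite L0 ltxx.
by rewrite leNgt PG.
Qed.

Let neg_measurable (t c : R) :
  measurable (`]0, t] `&` phi @^-1` `]-oo, c[ : set (measurableTypeR R)).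
Proof. by apply: (measurable_funTS mphi) => //; exact: measurable_itv. Qed.

(** [phi_below_null] at [v = n + 1] for every [n]: arbitrarily large parameters push the threshold
    [- 1 / v] up to 0. *)
Lemma phi_neg_null (t : R) : 0 < t -> m (`]0, t] `&` phi @^-1` `]-oo, 0[) = 0%E.
Proof.
move=> t0; apply: measure_negligible; first exact: neg_measurable.
have : m.-negligible (\bigcup_n (`]0, t] `&` phi @^-1` `]-oo, (- (n.+1%:R : R)^-1)[)).
  apply: negligible_bigcup => n; exists (`]0, t] `&` phi @^-1` `]-oo, (- (n.+1%:R : R)^-1)[); split => //.
  by apply: phi_below_null; rewrite ?ltr0n.
apply: negligibleS => s [st]; rewrite /= in_itv/= => s0.
have [n _ hn] : \forall n \near \oo, n.+1%:R^-1 < - phi s.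
  have := @cvg_harmonic R; move/cvgr_lt; apply; by rewrite oppr_gt0.
exists n => //; split => //; rewrite /= in_itv/=.
by rewrite ltrNr; exact: (hn n (leqnn n)).
Qed.

(** The event on which every factor [1 + v phi(T_n)] up to [t] is at least 1, for all [v >= 0]
    together. Being the event of a zero count, it lies in [F t]. *)
Let good (t : R) : set Omega :=
  [set w | forall n, T n w <= t -> 0 <= phi (T n w)].

Let goodE (t : R) : 0 < t -> good t =
  [set w | jump_measure T Z w ((`]0, t] `&` phi @^-1` `]-oo, 0[) `*` setT) = 0%:R%:E].
Proof.
move=> t0; have [N NE] := jump_count_fun t jT.
apply/seteqP; split => w.
  move=> gw; rewrite /= (jump_measureE Z (fun n => jump_times_gt0 w n jT) (NE w)); last first.
    by move=> p [[]].
  congr EFin; rewrite big1// => n _; rewrite indicE memNset// => -[[_ neg] _].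
  move: neg; rewrite /= in_itv/= ltNge => /negP; apply; apply: gw.
  by rewrite NE.
rewrite /= (jump_measureE Z (fun n => jump_times_gt0 w n jT) (NE w)); last first.
  by move=> p [[]].
move=> [h] n nt; rewrite leNgt; apply/negP => neg.
have nN : (n < N w)%N by rewrite -NE.
move/eqP: h; rewrite gt_eqF// (bigD1 (Ordinal nN))//= indicE mem_set.
  by rewrite ltr_wpDr// sumr_ge0// => j _; rewrite indicE.
by split => //; split; rewrite /= in_itv/= ?nt ?jump_times_gt0.
Qed.

Let good_event (t : R) : 0 < t -> F t (good t).
Proof.
move=> t0; rewrite goodE//; apply: (jump_count_event poi 0 (ltW t0)).
  by apply: measurableX => //; exact: neg_measurable.
by move=> p [[]].
Qed.

Let good_measurable (t : R) : 0 < t -> measurable (good t).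
Proof. by move=> t0; apply: (filtration_measurable filF (ltW t0)); exact: good_event. Qed.

Let good_full (t : R) : 0 < t -> P (~` good t) = 0%E.
Proof.
move=> t0; rewrite probability_setC; last exact: good_measurable.
suff -> : P (good t) = 1%E by rewrite subee.
have mB := neg_measurable t 0.
have -> : good t = [set w | forall i : 'I_1, jump_measure T Z w
    ((`]0, t] `&` phi @^-1` `]-oo, 0[) `*` setT) = 0%:R%:E].
  rewrite goodE//; apply/seteqP; split => w /=; first by [].
  by move=> /(_ ord0).
rewrite (@jump_count_joint_law _ _ _ P F _ T Z filF poi 1
  (fun _ => (`]0, t] `&` phi @^-1` `]-oo, 0[) `*` setT) (fun _ => 0%N)).
- by rewrite big_ord1 /= strip_measure// phi_neg_null//= poisson_prob0.
- by move=> _; exact: measurableX.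
- by move=> _ p [[+ _] _]; rewrite /= !in_itv/= => /andP[-> _].
- by move=> _; rewrite [X in (X < _)%E]strip_measure// phi_neg_null// ltry.
- by apply/trivIsetP => i j _ _; rewrite (ord1 i) (ord1 j) eqxx.
Qed.

(** On [F t] the law [Pr v] has a density with respect to [P], so it inherits the null sets of
    [P]. *)
Let good_full_Pr (t v : R) : 0 < t -> 0 <= v -> Pr v (~` good t) = 0%E.
Proof.
move=> t0 v0; have [_ iL ->] := dens v0 (ltW t0).
  apply: null_set_integral; last exact: good_full.
    exact/measurableC/good_measurable.
  by apply: measurable_funTS; apply: (measurable_int P); exact: iL.
by apply: (filtrationC filF (ltW t0)); exact: good_event.
Qed.

Let likelihood_gt0 (t v : R) w : 0 < t -> 0 <= v -> good t w -> 0 < L v t w.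
Proof.
move=> t0 v0 gw; have [N NE] := jump_count_fun t jT.
rewrite (likelihood_product v0 (ltW t0) (NE w)) mulr_gt0 ?expR_gt0//.
apply: prodr_gt0 => n _; rewrite ltr_pwDl// mulr_ge0//.
by apply: gw; rewrite NE.
Qed.

Let A (j : nat) (t : R) : R := \int[m]_(s in `]0, t]) (phi s ^+ j).

(* q is the square root of L v t * L th t where the latter is known to be
   nonnegative. *)
Lemma hellinger_affinity (v th t : R) : 0 <= v -> 0 <= th -> 0 < t ->
  m.-integrable `]0, t] (EFin \o (fun s => phi s ^+ 2)) ->
  m.-integrable `]0, t] (EFin \o (fun s => phi s ^+ 3)) ->
  exists q : Omega -> R, [/\ measurable_fun [set: Omega] q, forall w, 0 <= q w,
    forall w, good t w -> q w ^+ 2 = L v t w * L th t w &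
    (\int[P]_w (q w)%:E <=
      (expR (- ((v - th) ^+ 2 / 8 * (A 2 t - (v + th) / 2 * A 3 t))))%:E)%E].
Proof.
move=> v0 th0 t0 i2 i3; have [N NE] := jump_count_fun t jT.
pose D : set (measurableTypeR R) := `]0, t]%classic.
have mD : measurable D by exact: measurable_itv.
(* The positive part makes the logarithm below nonnegative everywhere, as the exponential moment
   bound demands; it agrees with [phi] almost everywhere and at the jumps of a path in [good t]. *)
pose g s := Num.max (phi s) 0.
have g0 s : 0 <= g s by rewrite le_max lexx orbT.
have mg : measurable_fun [set: measurableTypeR R] g by exact: measurable_maxr.
pose G s := (1 + v * g s) * (1 + th * g s).
have G1 s : 1 <= G s.
  by rewrite -[1]mulr1 ler_pM// lerDl mulr_ge0.
have mG : measurable_fun [set: measurableTypeR R] G.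
  by apply: measurable_funM; apply: measurable_funD => //; exact: measurable_funM.
pose h s := ln (G s) / 2.
have h0 s : 0 <= h s by rewrite divr_ge0// ln_ge0.
have mh : measurable_fun [set: measurableTypeR R] h.
  by apply: measurable_funM => //; apply: measurableT_comp => //; exact: measurable_ln.
have eh s : expR (h s) ^+ 2 = G s.
  by rewrite -expRM_natr /h -mulrA mulVf// mulr1 lnK// posrE (lt_le_trans _ (G1 s)).
pose f (p : RE) := \1_D p.1 * h p.1.
have mfst : measurable_fun [set: RE] (fst : RE -> measurableTypeR R) by exact: measurable_fst.
have mf : measurable_fun [set: RE] f.
  apply: measurable_funM; last exact: (measurableT_comp mh).
  have mI : measurable_fun [set: measurableTypeR R] (\1_D : measurableTypeR R -> R).
    exact: measurable_indic.
  exact: (measurableT_comp mI mfst).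
have f0 p : 0 <= f p by rewrite mulr_ge0.
have fin p : D p.1 -> f p = h p.1 by move=> Dp; rewrite /f indicE mem_set// mul1r.
have fout p : ~ (`]0, t] `*` setT) p -> f p = 0.
  by move=> nD; rewrite /f indicE memNset ?mul0r// => Dp; apply: nD.
pose C := (v + th) / 2; pose c := (v - th) ^+ 2 / 8.
(* The bound of [geometric_mean_le] minus 1, which dominates [expR (h s) - 1] wherever
   [phi s >= 0]. *)
pose b s := C * phi s - c * (phi s ^+ 2 - C * phi s ^+ 3).
have i1 := iphi t0.
have iC1 : m.-integrable D (EFin \o (fun s => C * phi s)) by exact: (integrableZl mD C i1).
have iC3 : m.-integrable D (EFin \o (fun s => C * phi s ^+ 3)) by exact: (integrableZl mD C i3).
have i23 : m.-integrable D (EFin \o (fun s => phi s ^+ 2 - C * phi s ^+ 3)).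
  exact: (integrableB mD i2 iC3).
have ic23 : m.-integrable D (EFin \o (fun s => c * (phi s ^+ 2 - C * phi s ^+ 3))).
  exact: (integrableZl mD c i23).
have ib : m.-integrable D (EFin \o b) by exact: (integrableB mD iC1 ic23).
have intb : (\int[m]_(s in D) (b s)%:E =
    (C * A 1 t - c * (A 2 t - C * A 3 t))%:E)%E.
  rewrite -[LHS]fineK; last exact: (integrable_fin_num mD ib).
  congr EFin; rewrite -/(Rintegral m D b) /b RintegralB// RintegralZl// RintegralZl//.
  rewrite RintegralB// RintegralZl//.
pose I := C * A 1 t - c * (A 2 t - C * A 3 t).
have intf : (\int[m \x eta]_p (expR (f p) - 1)%:E <= I%:E)%E.
  have -> : (\int[m \x eta]_p (expR (f p) - 1)%:E =
      \int[m]_(s in D) (expR (h s) - 1)%:E)%E.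
    rewrite -(integral_fst m eta mD (f := fun s => (expR (h s) - 1)%:E)); last first.
      apply/measurable_EFinP; apply: measurable_funTS; apply: measurable_funB => //.
      by apply: measurableT_comp mh; exact: measurable_expR.
    rewrite [RHS]integral_mkcond; apply: eq_integral => p _.
    rewrite patchE; case: ifPn => [/set_mem[Dp _]|/negP nDp]; first by rewrite fin.
    by rewrite fout ?expR0 ?subrr// => Dp; apply: nDp; rewrite inE.
  pose Neg : set (measurableTypeR R) := D `&` phi @^-1` `]-oo, 0[.
  have mNeg : measurable Neg := neg_measurable t 0.
  have Neg0 : m Neg = 0%E := phi_neg_null t0.
  have mDN : measurable (D `\` Neg) by exact: measurableD.
  have meh : measurable_fun D (fun s => (expR (h s) - 1)%:E).
    apply/measurable_EFinP; apply: measurable_funTS; apply: measurable_funB => //.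
    by apply: measurableT_comp mh; exact: measurable_expR.
  have eh0 s : 0 <= expR (h s) - 1 by rewrite subr_ge0 -expR0 ler_expR.
  rewrite /I -intb (negligible_integral mNeg mD ib Neg0).
  rewrite (ge0_negligible_integral mNeg mD meh _ Neg0); last first.
    by move=> s _; rewrite lee_fin.
  have le_b s : (D `\` Neg) s -> expR (h s) - 1 <= b s.
    move=> [Ds nN]; have phi0 : 0 <= phi s.
      by rewrite leNgt; apply/negP => ns; apply: nN; split => //; rewrite /= in_itv.
    have gphi : g s = phi s by rewrite /g max_l.
    have := @geometric_mean_le R v th (g s) (expR (h s)) v0 th0 (g0 s) (eh s).
    by rewrite gphi /b -/C -/c; lra.
  apply: ge0_le_integral => //.
  - by move=> s _; rewrite lee_fin.
  - exact: (measurable_funS mD (@subDsetl _ D Neg) meh).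
  - apply: (measurable_funS mD (@subDsetl _ D Neg)).
    by apply: (measurable_int m); exact: ib.
have [mE intE] := jump_exponential_moment_le filF jT poi (ltW t0) NE mf f0 fout intf.
(* The prefactor is the geometric mean of the two compensator factors of the likelihoods; it cancels
   the linear part [C * A 1 t] of [I]. *)
exists (fun w => expR (- (C * A 1 t)) * expR (\sum_(n < N w) f (T n w, Z n w))).
split.
- exact: measurable_funM.
- by move=> w; rewrite mulr_ge0 ?expR_ge0.
- move=> w gw; rewrite !(likelihood_product _ (ltW t0) (NE w))// exprMn -expRM_natr.
  have -> : expR (\sum_(n < N w) f (T n w, Z n w)) ^+ 2 =
      \prod_(n < N w) (1 + v * phi (T n w)) * \prod_(n < N w) (1 + th * phi (T n w)).
    rewrite -big_split/= expR_sum -prodrXl; apply: eq_bigr => n _.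
    have Tn : T n w <= t by rewrite NE.
    rewrite fin; last by rewrite /D /= in_itv/= jump_times_gt0.
    by rewrite eh /G /g max_l//; exact: gw.
  rewrite mulrACA -expRD; congr (expR _ * _).
  by rewrite /C /A; under eq_Rintegral do rewrite expr1; field.
- under eq_integral do rewrite EFinM.
  rewrite ge0_integralZl ?lee_fin ?expR_ge0//; last exact/measurable_EFinP.
  apply: (@le_trans _ _ ((expR (- (C * A 1 t)))%:E * (expR I)%:E)%E).
    by rewrite lee_pmul2l ?lte_fin ?expR_gt0.
  by rewrite -EFinM lee_fin -expRD /I addrA addNr add0r.
Qed.

(** Likelihood ratio test: [B] is the part of [good t] where [L v t < L th t]. On [B] the density
    [L v t] is at most [q], and on [good t] outside [B] it is [L th t] that is at most [q]; both
    errors are thus bounded by the affinity. *)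
Lemma separating_event (v th t : R) : 0 <= v -> 0 <= th -> 0 < t ->
  m.-integrable `]0, t] (EFin \o (fun s => phi s ^+ 2)) ->
  m.-integrable `]0, t] (EFin \o (fun s => phi s ^+ 3)) ->
  let e := expR (- ((v - th) ^+ 2 / 8 * (A 2 t - (v + th) / 2 * A 3 t))) in
  exists B, [/\ F t B, (Pr th (~` B) <= e%:E)%E & (Pr v B <= e%:E)%E].
Proof.
move=> v0 th0 t0 i2 i3 e.
have [q [mq q0 q2 intq]] := hellinger_affinity v0 th0 t0 i2 i3.
have [mv iv dv] := dens v0 (ltW t0); have [mth ith dth] := dens th0 (ltW t0).
have [sF _ _] := filF.
pose le_set := [set w | L th t w <= L v t w].
have Fle : F t le_set by exact: sigma_algebra_le_set (sF _ (ltW t0)) mth mv.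
have Fg := good_event t0.
have FI := filtrationI filF (ltW t0); have FC := filtrationC filF (ltW t0).
have FU := filtrationU filF (ltW t0).
have mF D : F t D -> measurable D by exact: (filtration_measurable filF (ltW t0)).
have bound u D : 0 <= u -> F t D -> D `<=` good t ->
    (forall w, D w -> L u t w ^+ 2 <= L v t w * L th t w) -> (Pr u D <= e%:E)%E.
  move=> u0 FD Dg DL; have [mu_ iu ->//] := dens u0 (ltW t0).
  have mD := mF _ FD.
  have mLu : measurable_fun [set: Omega] (EFin \o L u t).
    by apply: (measurable_int P); exact: iu.
  apply: le_trans intq; apply: (@le_trans _ _ (\int[P]_(w in D) (q w)%:E)%E).
    apply: ge0_le_integral => //.
    - by move=> w /Dg gw; rewrite lee_fin ltW//; exact: likelihood_gt0.
    - exact: measurable_funTS.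
    - by apply: measurable_funTS; exact/measurable_EFinP.
    - move=> w Dw; rewrite lee_fin; have gw := Dg _ Dw.
      rewrite -(@ler_pXn2r _ 2)// ?nnegrE//; last exact/ltW/likelihood_gt0.
      by rewrite q2//; exact: DL.
  apply: ge0_subset_integral => //; first exact/measurable_EFinP.
  by move=> w _; rewrite lee_fin.
exists (good t `&` ~` le_set); split.
- by apply: FI => //; exact: FC.
- have -> : ~` (good t `&` ~` le_set) = ~` good t `|` (good t `&` le_set).
    by rewrite setCI setCK setUIr (setUC (~` _) (good t)) setUv setTI.
  apply: le_trans (measureU2 _ _ _) _.
  - exact/mF/FC.
  - exact/mF/FI.
  rewrite [X in (X + _)%E](good_full_Pr t0 th0) add0e; apply: bound => //.
  + exact: FI.
  + by move=> w [gw lw]; rewrite expr2 ler_pM2r//; exact: likelihood_gt0.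
- apply: bound => //.
  + by apply: FI => //; exact: FC.
  + move=> w [gw /negP]; rewrite -ltNge => /ltW lw.
    by rewrite expr2 ler_pM2l//; exact: likelihood_gt0.
Qed.

Lemma phi_jumps_ge0 (v : R) : 0 <= v ->
  {ae Pr v, forall w, forall n, 0 <= phi (T n w)}.
Proof.
move=> v0; have : (Pr v).-negligible (\bigcup_k ~` good k.+1%:R).
  apply: negligible_bigcup => k; exists (~` good k.+1%:R); split => //.
    exact/measurableC/good_measurable.
  by apply: good_full_Pr.
apply: negligibleS => w /= /existsNP[n]; set t := T n w => nphi.
exists (Num.truncn t) => // gw; apply: nphi; apply: gw.
exact/ltW/truncnS_gt.
Qed.

Hypothesis iphi2 : forall t : R, 0 < t ->
  m.-integrable `]0, t] (EFin \o (fun s => phi s ^+ 2)).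
Hypothesis iphi3 : forall t : R, 0 < t ->
  m.-integrable `]0, t] (EFin \o (fun s => phi s ^+ 3)).
Hypothesis A2_cvg : \int[m]_(s in `]0, t]) (phi s ^+ 2) @[t --> +oo] --> +oo.
Hypothesis A3_cvg : (\int[m]_(s in `]0, t]) (phi s ^+ 3)) /
  (\int[m]_(s in `]0, t]) (phi s ^+ 2)) @[t --> +oo] --> (0 : R).

Lemma separating_event_small (v th e : R) : 0 <= v -> 0 <= th -> v != th -> 0 < e ->
  exists t B, [/\ 0 < t, F t B, (Pr th (~` B) <= e%:E)%E & (Pr v B <= e%:E)%E].
Proof.
move=> v0 th0 vth e0.
pose c := (v - th) ^+ 2 / 8; pose C := (v + th) / 2.
have c0 : 0 < c by rewrite divr_gt0// exprn_even_gt0//= subr_eq0.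
have C0 : 0 <= C by rewrite divr_ge0// addr_ge0.
have C10 : 0 < C + 1 by exact: ltr_wpDl.
(* The exponent factors as [c * A 2 t * (1 - C * (A 3 t / A 2 t))]; keeping the last factor above
   1/2 reduces the goal to [- ln e <= c * A 2 t / 2]. *)
have : \forall t \near +oo, [/\ 0 < t, 0 < A 2 t, C * (A 3 t / A 2 t) <= 2^-1 &
    - ln e <= c * (A 2 t / 2)].
  near=> t; split.
  - by near: t; exact: nbhs_pinfty_gt.
  - by near: t; move/cvgryPgt: A2_cvg; exact.
  - have h : A 3 t / A 2 t < (2 * (C + 1))^-1.
      near: t; move/cvgr_lt: A3_cvg; apply.
      by rewrite invr_gt0 mulr_gt0.
    apply: (@le_trans _ _ (C * (2 * (C + 1))^-1)); first by rewrite ler_wpM2l// ltW.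
    rewrite invfM mulrCA ler_piMr// ler_pdivrMr// mul1r lerDl//.
  - rewrite -ler_pdivrMl// ler_pdivlMr//.
    by near: t; move/cvgryPge: A2_cvg; exact.
case/(@filter_ex _ (pinfty_nbhs R)) => t [t0 A20 hC he].
have [B [FB h1 h2]] := separating_event v0 th0 t0 (iphi2 t0) (iphi3 t0).
have ee : expR (- ((v - th) ^+ 2 / 8 * (A 2 t - (v + th) / 2 * A 3 t))) <= e.
  rewrite -/c -/C -[leRHS](lnK (x := e)) ?posrE// ler_expR lerNl.
  apply: le_trans he _; rewrite ler_wpM2l ?(ltW c0)//.
  have -> : A 2 t - C * A 3 t = A 2 t * (1 - C * (A 3 t / A 2 t)).
    by field; rewrite gt_eqF.
  by rewrite ler_pM2l//; lra.
exists t, B; split => //.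
- by apply: le_trans h1 _; rewrite lee_fin.
- by apply: le_trans h2 _; rewrite lee_fin.
Unshelve. all: by end_near. Qed.

Lemma likelihood_eventually_lt (v th : R) : 0 <= v -> 0 <= th -> v != th ->
  {ae Pr th, forall w, \forall t \near +oo, L v t w < L th t w}.
Proof.
move=> v0 th0 vth.
pose e n : R := n.+1%:R^-1.
have e0 n : 0 < e n by rewrite invr_gt0 ltr0n.
have /choice[tB tBP] : forall n, exists tB : R * set Omega,
    [/\ 0 < tB.1, F tB.1 tB.2, (Pr th (~` tB.2) <= (e n)%:E)%E & (Pr v tB.2 <= (e n)%:E)%E].
  move=> n; have [t [B ?]] := separating_event_small v0 th0 vth (e0 n).
  by exists (t, B).
pose hits n := (tB n).2 `&` [set w | exists2 r : rat, (tB n).1 <= ratr r &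
  L th (ratr r) w <= 2 * L v (ratr r) w].
pose bad n := ~` (tB n).2 `|` hits n.
have mB n : measurable (tB n).2.
  by have [t0 FB _ _] := tBP n; exact: (filtration_measurable filF (ltW t0)).
have maxi n := let: And4 t0 FB _ _ := tBP n in
  @ratio_maximal_rat _ _ _ P (Pr th) (Pr v) F (L th) (L v) filF
    (fun t => dens th0) (fun t => dens v0) (tB n).1 (tB n).2 (ltW t0) FB.
have mhits n : measurable (hits n) by have [] := maxi n.
have mbad n : measurable (bad n) by apply: measurableU => //; exact: measurableC.
(* One [e n] pays for missing [B], and two for the maximal inequality. Only the intersection of the
   bad events matters, so [e n] tending to 0 suffices. *)
have bad_le n : (Pr th (bad n) <= (3 * e n)%:E)%E.
  apply: le_trans (measureU2 _ _ _) _ => //; first exact: measurableC.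
  have [_ _ h1 h2] := tBP n; have [_ h3] := maxi n.
  have -> : ((3 * e n)%:E = (e n)%:E + 2%:E * (e n)%:E)%E.
    by rewrite -EFinM -EFinD; congr EFin; ring.
  apply: leeD => //; apply: le_trans h3 _.
  by rewrite lee_pmul2l ?lte_fin.
have bad0 : (Pr th).-negligible (\bigcap_n bad n).
  have mcap : measurable (\bigcap_n bad n) by exact: bigcapT_measurable.
  exists (\bigcap_n bad n); split => //; apply/eqP; rewrite eq_le measure_ge0 andbT.
  have lim0 : ((3 * e n)%:E : \bar R) @[n --> \oo] --> 0%:E.
    apply: cvg_EFin; first by near=> n.
    rewrite -[X in _ --> X](mulr0 3); apply: cvgMr; exact: cvg_harmonic.
  apply: (cvge_to_ge lim0); near=> n.
  apply: le_trans (bad_le n); apply: le_measure; rewrite ?inE//.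
  exact: bigcap_inf.
have := negligibleU bad0 (phi_jumps_ge0 th0).
apply: negligibleS => w /= nh; apply: contrapT => /not_orP[nbad gw].
apply: nh; move/contrapT in gw.
have [n /not_orP[/contrapT Bw nhit]] : exists n, ~ bad n w.
  by apply/existsNP => h; apply: nbad => n _; exact: h.
have [t0 _ _ _] := tBP n.
have rat_lt (r : rat) : (tB n).1 <= ratr r -> 2 * L v (ratr r) w < L th (ratr r) w.
  move=> tr; rewrite ltNge; apply/negP => h; apply: nhit; split => //.
  by exists r.
near=> t.
have tBt : (tB n).1 <= t by near: t; apply: nbhs_pinfty_ge; exact: num_real.
have t_gt0 : 0 < t by exact: lt_le_trans tBt.
have Lth0 : 0 < L th t w by apply: likelihood_gt0 => // k _; exact: gw.
(* Right-continuity turns the strict inequality at rational times into a weak one at every real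
   time; the factor 2 and positivity of [L v t w] restore strictness. *)
suff le2 : 2 * L v t w <= L th t w.
  have Lv0 : 0 < L v t w by apply: likelihood_gt0 => // k _; exact: gw.
  by apply: lt_le_trans le2; rewrite ltr_pMl// ltr1n.
rewrite leNgt; apply/negP => lt2.
have [[rv _] _] := dd w v0; have [[rth _] _] := dd w th0.
have cv : 2 * L v x w - L th x w @[x --> t^'+] --> 2 * L v t w - L th t w.
  by apply: cvgB; [apply: cvgMr; exact: rv (ltW t_gt0)|exact: rth (ltW t_gt0)].
have : \forall x \near t^'+, 0 < 2 * L v x w - L th x w.
  by move/cvgr_gt : cv; apply; rewrite subr_gt0.
rewrite /at_right near_withinE => -[d' /= d'0 hd'].
have [r] := @rat_in_itvoo R t (t + d') (ltr_pwDr d'0 (lexx t)).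
rewrite in_itv/= => /andP[tr rd].
have := hd' (ratr r); rewrite /= ltr_norml => /(_ _ tr).
have -> : (- d' < t - ratr r) && (t - ratr r < d') by apply/andP; split; lra.
move=> /(_ isT); have := rat_lt r (le_trans tBt (ltW tr)); lra.
Unshelve. all: by end_near. Qed.

End model.

(** * The maximum likelihood estimator *)

Section product_likelihood.
Context {R : realType} (k : nat) (x : 'I_k -> R) (Phi : R).
Hypothesis x0 : forall n, 0 <= x n.

Let f (v : R) : R := expR (- (v * Phi)) * \prod_(n < k) (1 + v * x n).

Let fac_gt0 v n : 0 <= v -> 0 < 1 + v * x n.
Proof. by move=> v0; rewrite ltr_pwDl// mulr_ge0. Qed.

(* ln f is concave; s is its derivative at b. *)
Let tangent b : 0 <= b ->
  exists s, forall u, 0 <= u -> f u <= f b * expR (s * (u - b)).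
Proof.
move=> b0; exists (\sum_(n < k) x n / (1 + b * x n) - Phi) => u u0.
rewrite mulrBl expRD mulr_suml expR_sum /f.
have -> : expR (- (b * Phi)) * \prod_(n < k) (1 + b * x n) *
    (\prod_(n < k) expR (x n / (1 + b * x n) * (u - b)) * expR (- (Phi * (u - b)))) =
    (expR (- (b * Phi)) * expR (- (Phi * (u - b)))) *
    (\prod_(n < k) (1 + b * x n) * \prod_(n < k) expR (x n / (1 + b * x n) * (u - b))).
  by ring.
rewrite -expRD -big_split/= (_ : - (b * Phi) - Phi * (u - b) = - (u * Phi)); last by ring.
rewrite ler_wpM2l ?expR_ge0//; apply: ler_prod => n _.
rewrite ltW ?fac_gt0//=.
have bx := fac_gt0 n b0.
have -> : 1 + u * x n = (1 + b * x n) * (1 + x n / (1 + b * x n) * (u - b)).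
  by field; rewrite gt_eqF.
by rewrite ler_wpM2l ?(ltW bx)// expR_ge1Dx.
Qed.

Let f_gt0 v : 0 <= v -> 0 < f v.
Proof. by move=> v0; rewrite mulr_gt0 ?expR_gt0// prodr_gt0// => n _; exact: fac_gt0. Qed.

(** Since [f b < f a], the tangent slope at [b] points towards [a]; on the far side of [b] the
    tangent bound keeps [f] below [f b]. *)
Let outside a b u : 0 <= b -> 0 <= a -> 0 <= u -> f b < f a ->
  (u < b /\ b < a) \/ (a < b /\ b < u) -> f u < f a.
Proof.
move=> b0 a0 u0 fba cases; apply: le_lt_trans (fba).
have [s hs] := tangent b0.
have fb := f_gt0 b0.
have sa : 0 < s * (a - b).
  rewrite ltNge; apply/negP => sab.
  have := hs a a0; rewrite leNgt => /negP; apply.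
  apply: le_lt_trans _ (fba).
  by rewrite -[leRHS]mulr1 ler_pM2l// -expR0 ler_expR.
apply: le_trans (hs u u0) _.
rewrite -[leRHS]mulr1 ler_pM2l// -expR0 ler_expR.
by case: cases => -[h1 h2]; nra.
Qed.

Let f_continuous : continuous f.
Proof.
move=> v; apply: cvgM.
  apply: continuous_cvg; first exact: continuous_expR.
  by apply: cvgN; apply: cvgMl.
apply: cvg_big => [|n _]; first exact: mul_continuous.
by apply: cvgD; [exact: cvg_cst|apply: cvgMl].
Qed.

(** Existence matters as much as location: [is_mle] constrains the estimator only when a maximizer
    exists. Outside [[v1, v2]] the function is below [f a], so the maximum over this compact
    interval is global. *)
Lemma product_likelihood_argmax (a v1 v2 : R) : 0 <= v1 -> v1 < a -> a < v2 ->
  f v1 < f a -> f v2 < f a ->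
  (exists c, is_argmax_ge0 f c) /\ (forall c, is_argmax_ge0 f c -> v1 <= c <= v2).
Proof.
move=> v10 v1a av2 f1 f2.
have a0 : 0 <= a by exact: le_trans (ltW v1a).
have v20 : 0 <= v2 by exact: le_trans (ltW av2).
have out u : 0 <= u -> u < v1 \/ v2 < u -> f u < f a.
  move=> u0 [uv1|uv2].
    by apply: (outside v10 a0 u0 f1); left.
  by apply: (outside v20 a0 u0 f2); right.
split.
  have [c] := EVT_max (ltW (lt_trans v1a av2)) (continuous_subspaceT f_continuous).
  rewrite in_itv/= => /andP[v1c cv2] cmax; exists c; split; first exact: le_trans v1c.
  have fac : f a <= f c by apply: cmax; rewrite in_itv/= !ltW.
  move=> u u0; have [uv1|v1u] := ltP u v1.
    by apply: le_trans fac; apply/ltW/out => //; left.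
  have [v2u|uv2] := ltP v2 u.
    by apply: le_trans fac; apply/ltW/out => //; right.
  by apply: cmax; rewrite in_itv/= v1u.
move=> c [c0 /(_ a a0) fac]; apply/andP; split; rewrite leNgt; apply/negP => h.
  by have := out c c0 (or_introl h); rewrite ltNge fac.
by have := out c c0 (or_intror h); rewrite ltNge fac.
Qed.

End product_likelihood.

Theorem theorem2 (R : realType) (d : measure_display) (Omega : measurableType d)
    (P : probability Omega R) (F : R -> set (set Omega))
    (lam : R -> R) (lam_ge0 : forall s, 0 <= lam s)
    (lam_meas : measurable_fun [set: measurableTypeR R] lam)
    (eta : probability (measurableTypeR R) R)
    (T Z : nat -> Omega -> R) (K : R -> R -> R) (phi : R -> R)
    (L : R -> R -> Omega -> R) (Pr : R -> probability Omega R)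
    (theta_hat : R -> Omega -> R) (theta : R) :
  let lds := time_intensity lam_ge0 lam_meas in
  let nu := (lds \x eta)%E in
  let mu := jump_measure T Z in
  is_filtration F ->
  is_jump_times T ->
  is_poisson_process F P nu mu ->
  is_kernel K nu ->
  solves_drift_equation K nu phi ->
  (forall psi, solves_drift_equation K nu psi ->
     {ae lds, forall s, 0 < s -> psi s = phi s}) ->
  (forall v w, 0 <= v ->
     is_doleans_dade (mu w) nu (fun p => v * phi p.1) (fun t => L v t w)) ->
  (forall v t, 0 <= v -> 0 <= t -> is_density_on (F t) P (Pr v) (L v t)) ->
  is_mle L theta_hat ->
  0 < theta ->
  (forall t, 0 < t -> lds.-integrable `[0, t] (EFin \o phi)) ->
  (forall t, 0 < t ->
     lds.-integrable `[0, t] (fun s => (ln (1 + theta * phi s))%:E)) ->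
  (forall (j : nat) (t : R), 0 < t ->
     lds.-integrable `[0, t] (fun s => (phi s ^+ (2 + j))%:E)) ->
  \int[lds]_(s in `[0, t]) (phi s ^+ 2) @[t --> +oo] --> +oo ->
  (forall j : nat, (0 < j)%N ->
     (\int[lds]_(s in `[0, t]) (phi s ^+ (2 + j))) /
     (\int[lds]_(s in `[0, t]) (phi s ^+ 2)) @[t --> +oo] --> (0 : R)) ->
  {ae Pr theta, forall w, theta_hat t w @[t --> +oo] --> theta}.
Proof.
move=> lds nu mu filF jT poi _ [mphi _] _ dd dens mle th_gt0 iphi0 _ ipow0 A2_cvg0 A3_cvg0.
have th0 := ltW th_gt0.
have atomless t : lds [set t] = 0%E by exact: integral_set1.
have sub (t : R) : (`]0, t]%classic : set (measurableTypeR R)) `<=` `[0, t].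
  by move=> s /=; rewrite !in_itv/= => /andP[/ltW -> ->].
have iphi (t : R) : 0 < t -> lds.-integrable `]0, t] (EFin \o phi).
  by move=> t0; apply: integrableS (iphi0 t t0) => //; exact: sub.
have ipow (j : nat) (t : R) : 0 < t ->
    lds.-integrable `]0, t] (EFin \o (fun s => phi s ^+ (2 + j))).
  by move=> t0; apply: integrableS (ipow0 j t t0) => //; exact: sub.
(* The assumptions integrate over [[0, t]], the stochastic equation over []0, t]]; the point 0 has
   no mass. *)
have int_oc (j : nat) (t : R) : 0 < t ->
    \int[lds]_(s in `[0, t]) (phi s ^+ (2 + j)) = \int[lds]_(s in `]0, t]) (phi s ^+ (2 + j)).
  move=> t0; congr fine.
  have m0 : measurable ([set 0] : set (measurableTypeR R)) by exact: measurable_set1.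
  have m0t : measurable (`[0, t]%classic : set (measurableTypeR R)) by exact: measurable_itv.
  rewrite (negligible_integral m0 m0t (ipow0 j t t0) (atomless 0)).
  congr (integral _ _ _); apply/seteqP; split => s /=; rewrite !in_itv/=.
    move=> [/andP[s0 ->] ns]; rewrite andbT lt_neqAle s0 andbT.
    by apply/eqP => s0'; apply: ns.
  by move=> /andP[s0 ->]; split; [rewrite (ltW s0)|move=> s0'; rewrite s0' ltxx in s0].
have A2_cvg : \int[lds]_(s in `]0, t]) (phi s ^+ 2) @[t --> +oo] --> +oo.
  apply: cvg_trans A2_cvg0; apply: near_eq_cvg; near=> t.
  by rewrite -(int_oc 0)//; near: t; exact: nbhs_pinfty_gt.
have A3_cvg : (\int[lds]_(s in `]0, t]) (phi s ^+ 3)) /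
    (\int[lds]_(s in `]0, t]) (phi s ^+ 2)) @[t --> +oo] --> (0 : R).
  apply: cvg_trans (A3_cvg0 1%N isT); apply: near_eq_cvg; near=> t.
  have t0 : 0 < t by near: t; exact: nbhs_pinfty_gt.
  by rewrite -(int_oc 0 t t0) -(int_oc 1 t t0).
pose lo n := theta - theta / n.+2%:R; pose hi n := theta + theta / n.+2%:R.
have step n : 0 < theta / n.+2%:R by rewrite divr_gt0// ltr0n.
have lo0 n : 0 <= lo n.
  by rewrite subr_ge0 ler_pdivrMr ?ltr0n// ler_peMr// ler1n.
have lo_lt n : lo n < theta by rewrite ltrBlDr ltrDl.
have hi_gt n : theta < hi n by rewrite ltrDl.
have hi0 n : 0 <= hi n by rewrite (le_trans th0)// ltW.
have ev v : 0 <= v -> v != theta ->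
    {ae Pr theta, forall w, \forall t \near +oo, L v t w < L theta t w}.
  move=> v0 vth.
  exact: (likelihood_eventually_lt atomless filF jT poi mphi iphi dd dens
    (ipow 0%N) (ipow 1%N) A2_cvg A3_cvg v0 th0 vth).
have ev_lo n := ev (lo n) (lo0 n) (negbT (lt_eqF (lo_lt n))).
have ev_hi n := ev (hi n) (hi0 n) (negbT (gt_eqF (hi_gt n))).
(* Only countably many competitors are tested, so one null set serves every [n]; concavity in the
   parameter takes care of the others. *)
have ev_all : {ae Pr theta, forall w, forall n,
    (\forall t \near +oo, L (lo n) t w < L theta t w) /\
    (\forall t \near +oo, L (hi n) t w < L theta t w)}.
  apply/ae_foralln => n; apply: filterS2 (ev_lo n) (ev_hi n) => w; split=> //.
have phi_ge0 := phi_jumps_ge0 atomless filF jT poi mphi iphi dd dens th0.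
apply: filterS2 ev_all phi_ge0 => w evw phiw.
apply/cvgrPdist_le => e e0.
have [n _ hn] : \forall n \near \oo, n.+1%:R^-1 < e / theta.
  by have := @cvg_harmonic R; move/cvgr_lt; apply; rewrite divr_gt0.
have [evlo evhi] := evw n.
near=> t.
have t0 : 0 <= t by apply/ltW; near: t; exact: nbhs_pinfty_gt.
have Llo : L (lo n) t w < L theta t w by near: t.
have Lhi : L (hi n) t w < L theta t w by near: t.
have [N NE] := jump_count_fun t jT.
have LE v : 0 <= v -> L v t w = expR (- (v * \int[lds]_(s in `]0, t]) phi s)) *
    \prod_(k < N w) (1 + v * phi (T k w)).
  by move=> v0; exact: (likelihood_product atomless jT mphi iphi dd v0 t0 (NE w)).
pose f u := expR (- (u * \int[lds]_(s in `]0, t]) phi s)) *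
    \prod_(k < N w) (1 + u * phi (T k w)).
have argE c : is_argmax_ge0 (fun u => L u t w) c <-> is_argmax_ge0 f c.
  split=> -[c0 cmax]; split => // u u0; last by rewrite !LE//; exact: cmax.
  by have := cmax u u0; rewrite !LE.
have flo : f (lo n) < f theta by move: Llo; rewrite !LE.
have fhi : f (hi n) < f theta by move: Lhi; rewrite !LE.
have [[c cmax] between] := product_likelihood_argmax
  (fun k : 'I_(N w) => phiw k) (lo0 n) (lo_lt n) (hi_gt n) flo fhi.
have hatmax : is_argmax_ge0 f (theta_hat t w).
  by apply/argE; apply: mle => //; exists c; apply/argE.
have /andP[h1 h2] := between _ hatmax.
have step_le : theta / n.+2%:R <= e.
  have := hn n (leqnn n); rewrite ltr_pdivlMr// mulrC => /ltW; apply: le_trans.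
  by rewrite ler_pM2l// lef_pV2 ?posrE ?ltr0n// ler_nat.
apply: le_trans step_le; move: h1 h2; rewrite /lo /hi.
by move: (theta / _) (theta_hat t w) => x y h1 h2; rewrite ler_norml; apply/andP; split; lra.
Unshelve. all: by end_near. Qed.
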